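(* Let $H$ be a Hilbert space and let $\mathcal T=(T(t))_{t\ge 0}\subset\mathcal L(H)$ be a semigroup (no measurability or continuity assumed). Suppose that there exist equivalent Hilbertian norms $\|\cdot\|_1$ and $\|\cdot\|_2$ on $H$, constants $C_1,C_2\ge 1$, and parameters $\lambda,\tau>0$ such that $$\|h\|\le\|h\|_j\le C_j\|h\|\quad(h\in H,\ j=1,2),\qquad \|T(t)\|_1\le e^{\lambda t}\quad(t\ge 0),\qquad \|T(\tau)\|_2\le 1 .$$ Let $q$ and $F_h^+$ ($h\in H$) be as defined in the context. Then the mapping $$\|h\|_{\rm eq}:=\inf\bigl\{\sqrt{q(f)}\,:\, f\in F_h^+\bigr\},\qquad h\in H,$$ is an equivalent Hilbertian norm on $H$ such that $\|T(t)h\|_{\rm eq}\le\|h\|_{\rm eq}$ for all $h\in H$, $t\ge 0$. In particular, $\mathcal T\in\mathcal{SC}(H)$. Moreover, $$\frac1{M_2}\|h\|\le\|h\|_{\rm eq}\le M_1\|h\|,\qquad h\in H,$$ where $$M_1=\Bigl(C_1^2\,\frac{1-e^{-4\lambda}}{2\lambda}+2C_2^2\sup_{s\in[0,\tau)}\|T(s)\|^2\Bigr)^{1/2},\qquad M_2=\Bigl(\frac{e^{4\lambda}-1}{2\lambda}+4\max\{1,\tau\}\sup_{s\in[0,1]}\|T(s)\|^2\Bigr)^{1/2}.$$ Consequently, $\mathcal C(\mathcal T)\le\mathcal C_H(\|\cdot\|_{\rm eq})\le M_1M_2$.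
   Context: Hilbert spaces are complex with inner products linear in the first variable; $\mathcal L(H)$ denotes the bounded operators on $H$. A semigroup is a family $(T(t))_{t\ge0}\subset\mathcal L(H)$ with $T(0)=I$ and $T(s+t)=T(s)T(t)$. A Hilbertian norm is a norm induced by an inner product; $\|T\|_j$ is the operator norm of $T$ with respect to $\|\cdot\|_j$, and $\langle\cdot,\cdot\rangle_j$ is the inner product inducing $\|\cdot\|_j$. $\mathcal T\in\mathcal{SC}(H)$ means that there is an invertible $R\in\mathcal L(H)$ with $\|RT(t)R^{-1}\|\le1$ for all $t\ge0$; $\mathcal C(\mathcal T)$ is the infimum of $\|R\|\,\|R^{-1}\|$ over all such $R$ ($=\infty$ if there are none). For an equivalent Hilbertian norm $\|\cdot\|_\sharp$ on $H$, $\mathcal C_H(\|\cdot\|_\sharp):=\inf\{MN:\ \|h\|\le M\|h\|_\sharp,\ \|h\|_\sharp\le N\|h\|\ \text{for all }h\in H\}$. Invariant means: let $\mathbb T=\mathbb R/\mathbb Z$ and fix a positive linear functional $m:\ell^\infty(\mathbb T)\to\mathbb C$ with $m(1)=1$ that is invariant under translations $\varphi\mapsto\varphi(\cdot+s)$ and under inversion $\varphi\mapsto\varphi(-\,\cdot)$. For $a>0$ and $f\in\ell^\infty([0,a))$ set $\mu_a(f):=m(J_af)$, where $(J_af)(t/a+\mathbb Z):=f(t)$, $t\in[0,a)$. Under the hypotheses, $\mathcal T$ is bounded on compact intervals. Define the semi-inner product $\langle h,g\rangle_0:=\mu_\tau\bigl(\langle T(\cdot)h,T(\cdot)g\rangle_2\bigr)$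 on $H$; let $N_0=\{h:\|h\|_0=0\}$, let $H_0$ be the completion of $H/N_0$ (its inner product is again denoted $\langle\cdot,\cdot\rangle_0$), and $J_0:H\to H_0$ the canonical map. The formula $T_0(t)J_0h:=J_0T(t)h$ defines a semigroup $(T_0(t))_{t\ge0}$ of contractions on $H_0$. Put $\Phi_0(t)=T_0(t)$ for $t\ge0$ and $\Phi_0(t)=T_0(-t)^*$ for $t<0$. Let $F^+$ be the vector space of finitely supported functions $f:[0,\infty)\to H$, written $f=\sum_{j=1}^n\delta_{t_j}\otimes h_j$ with $t_j\ge0$, $h_j\in H$, where $\delta_t\otimes h$ is the function equal to $h$ at $t$ and $0$ elsewhere. Let $a(s,t):=\max\{1-|s-t|,0\}$ and let $\chi_\Delta$ denote the characteristic function of $\Delta$. For $f=\sum_{j=1}^n\delta_{t_j}\otimes h_j$ and $g=\sum_{\ell=1}^m\delta_{s_\ell}\otimes g_\ell$ in $F^+$ define $$\langle f,g\rangle_\alpha:=\int_0^2e^{-2\lambda r}\Bigl\langle\sum_{j}T(t_j)h_j\chi_{[t_j,t_j+1]}(r),\ \sum_{\ell}T(s_\ell)g_\ell\chi_{[s_\ell,s_\ell+1]}(r)\Bigr\rangle_1dr,$$ $$\langle f,g\rangle_\beta:=\sum_{j}\sum_{\ell}\bigl(1+a(t_j,s_\ell)\bigr)\bigl\langle\Phi_0(t_j-s_\ell)J_0h_j,J_0g_\ell\bigr\rangle_0,$$ $\langle f,g\rangle_q:=\langle f,g\rangle_\alpha+\langle f,g\rangle_\beta$, and $q(f):=\langle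 f,f\rangle_q$ (which is nonnegative). Finally let $\Sigma:F^+\to H$, $\Sigma\bigl(\sum_j\delta_{t_j}\otimes h_j\bigr):=\sum_jT(t_j)h_j$, and $F_h^+:=\{f\in F^+:\Sigma f=h\}$ for $h\in H$. *)

(* Defs.v *)
From HB Require Import structures.
From mathcomp Require Import all_boot all_order all_algebra.
From mathcomp Require Import generic_quotient ring_quotient sesquilinear.
From mathcomp Require Import complex.
From mathcomp Require Import all_classical all_reals all_analysis.

Set Implicit Arguments.
Unset Strict Implicit.
Unset Printing Implicit Defensive.

Import Order.TTheory GRing.Theory Num.Theory.
Import numFieldNormedType.Exports.

Local Open Scope classical_set_scope.
Local Open Scope complex_scope.
Local Open Scope ring_scope.

(* A {dot H for Num.conj} is linear in its first argument. *)
Notation inner_product H := {dot H for Num.conj}.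

HB.mixin Record isHilbert (R : realType) H & CompleteNormedModule R[i] H := {
  inner : inner_product H ;
  norm_inner : forall h : H, `|h| ^+ 2 = inner h h
}.

#[short(type="hilbertType")]
HB.structure Definition Hilbert (R : realType) :=
  {H of CompleteNormedModule R[i] H & isHilbert R H}.

Section norms.
Variables (R : realType) (H : hilbertType R).

(* The library norm of a normedModType over R[i] takes its values in R[i]. *)
Definition rnorm (h : H) : R := complex.Re `|h|.

Definition ipnorm (ip : inner_product H) (h : H) : R := Num.sqrt (complex.Re (ip h h)).

Definition opnorm (N : H -> R) (A : H -> H) : R :=
  sup [set N (A h) | h in [set h | N h <= 1]].

Definition equivalent_hilbertian_norm (N : H -> R) : Prop :=
  (exists ip : inner_product H, forall h, N h = ipnorm ip h) /\
  (exists c C : R, [/\ 0 < c, 0 < C &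
     forall h, c * rnorm h <= N h <= C * rnorm h]).

(* The constants are nonnegative: this matters only if H = {0}. *)
Definition CH (N : H -> R) : \bar R :=
  ereal_inf [set x | exists M M' : R, [/\ 0 <= M, 0 <= M',
    forall h, rnorm h <= M * N h, forall h, N h <= M' * rnorm h
    & x = (M * M')%:E]].

End norms.

Section semigroups.
Variables (R : realType) (H : hilbertType R).
Implicit Types (T : R -> {linear H -> H}) (A B : {linear H -> H}).

(* Only the values T t with t >= 0 are relevant, here and below. *)
Definition semigroup T : Prop :=
  [/\ forall t, 0 <= t -> continuous (T t),
      forall h, T 0 h = h
    & forall s t, 0 <= s -> 0 <= t -> forall h, T (s + t) h = T s (T t h)].

(* A is an invertible bounded operator with inverse B and A T(t) A^-1 is a
   contraction for all t >= 0. *)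
Definition contractive_similarity T A B : Prop :=
  [/\ continuous A, continuous B, cancel A B, cancel B A
    & forall t, 0 <= t -> opnorm (@rnorm R H) (A \o T t \o B) <= 1].

Definition SC T : Prop := exists A B, contractive_similarity T A B.

Definition similarity_constant T : \bar R :=
  ereal_inf [set x | exists A B, contractive_similarity T A B /\
    x = (opnorm (@rnorm R H) A * opnorm (@rnorm R H) B)%:E].

End semigroups.

Section invariant_means.
Variable R : realType.

(* R / Z; int_num_subdef is the predicate underlying Num.int *)
Definition circle : Type :=
  Quotient.quot [the zmodClosed R of (@Num.int_num_subdef R : {pred R})].

(* Functionals on all functions; only the values at bounded ones matter. *)
Definition invariant_mean (m : (circle -> R[i]) -> R[i]) : Prop :=
  let bnd (f : circle -> R[i]) := exists M, forall x, `|f x| <= M in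
  [/\ forall (c : R[i]) f g, bnd f -> bnd g ->
        m (fun x => c * f x + g x) = c * m f + m g,
      forall f, bnd f -> (forall x, 0 <= f x) -> 0 <= m f,
      m (fun=> 1) = 1,
      forall f s, bnd f -> m (fun x => f (x + s)) = m f
    & forall f, bnd f -> m (fun x => f (- x)) = m f].

Definition fracpart (y : R) : R := y - (Num.floor y)%:~R.

(* transport a f (t / a + Z) = f t for t in [0, a) *)
Definition transport (a : R) (f : R -> R[i]) : circle -> R[i] :=
  fun x => f (a * fracpart (repr x)).

Definition mean_on (m : (circle -> R[i]) -> R[i]) (a : R) (f : R -> R[i]) :
  R[i] := m (transport a f).

End invariant_means.

Section form.
Variables (R : realType) (H H0 : hilbertType R).
Implicit Types (T : R -> {linear H -> H}) (f g : R -> H).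

(* (H0, J0) is a Hilbert space completion of the quotient of H by the null
   space of the semi-inner product b; it is unique up to a unitary map that
   intertwines the maps J0. *)
Definition completion (b : H -> H -> R[i]) (J0 : {linear H -> H0}) : Prop :=
  (forall h k, inner (J0 h) (J0 k) = b h k) /\ dense (range J0).

Definition induced_semigroup T (J0 : {linear H -> H0})
    (T0 : R -> {linear H0 -> H0}) : Prop :=
  forall t, 0 <= t ->
    continuous (T0 t) /\ forall h, T0 t (J0 h) = J0 (T t h).

Definition adjoint (A B : H0 -> H0) : Prop :=
  forall x y, inner (A x) y = inner x (B y).

Definition two_sided_extension (T0 Phi0 : R -> {linear H0 -> H0}) : Prop :=
  (forall t, 0 <= t -> forall x, Phi0 t x = T0 t x) /\
  (forall t, t < 0 -> adjoint (T0 (- t)) (Phi0 t)).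

Definition mean_form (m : (circle R -> R[i]) -> R[i]) (tau : R)
    (ip2 : inner_product H) T (h k : H) : R[i] :=
  mean_on m tau (fun t => ip2 (T t h) (T t k)).

Definition supp f : set R := [set t | f t != 0].

(* Functions on [0, +oo) are extended by 0 to the real line. *)
Definition Fplus : set (R -> H) :=
  [set f | finite_set (supp f) /\ supp f `<=` `[0, +oo[].

Definition Rintegral_complex (D : set R) (F : R -> R[i]) : R[i] :=
  (\int[lebesgue_measure]_(r in D) complex.Re (F r)) +i*
  (\int[lebesgue_measure]_(r in D) complex.Im (F r)).

(* The forms below are additive in the vector attached to a given time, so
   they may be evaluated on the representation of f that uses each element of
   its support once, with h_j = f t_j. *)
Definition trajectory T f (r : R) : H :=
  \sum_(t \in supp f) ((\1_`[t, t + 1] r : R)%:C *: T t (f t)).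

Definition alpha_form (lambda : R) (ip1 : inner_product H) T f g : R[i] :=
  Rintegral_complex `[0, 2] (fun r =>
    (expR (- (2 * lambda * r)))%:C *
      ip1 (trajectory T f r) (trajectory T g r)).

Definition tent (s t : R) : R := Num.max (1 - `|s - t|) 0.

Definition beta_form (J0 : {linear H -> H0}) (Phi0 : R -> {linear H0 -> H0})
    f g : R[i] :=
  \sum_(t \in supp f) \sum_(s \in supp g)
    (1 + tent t s)%:C * inner (Phi0 (t - s) (J0 (f t))) (J0 (g s)).

Definition q_form lambda ip1 T J0 Phi0 f g : R[i] :=
  alpha_form lambda ip1 T f g + beta_form J0 Phi0 f g.

(* q_form is Hermitian, so that its diagonal values are real. *)
Definition q lambda ip1 T J0 Phi0 f : R :=
  complex.Re (q_form lambda ip1 T J0 Phi0 f f).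

Definition endpoint T f : H := \sum_(t \in supp f) T t (f t).

Definition norm_eq lambda ip1 T J0 Phi0 (h : H) : R :=
  inf [set Num.sqrt (q lambda ip1 T J0 Phi0 f) |
        f in Fplus `&` [set f | endpoint T f = h]].

Definition M1 (C1 C2 lambda tau : R) T : R :=
  Num.sqrt (C1 ^+ 2 * ((1 - expR (- (4 * lambda))) / (2 * lambda)) +
    2 * C2 ^+ 2 * sup [set opnorm (@rnorm R H) (T s) ^+ 2 | s in `[0, tau[]).

Definition M2 (lambda tau : R) T : R :=
  Num.sqrt ((expR (4 * lambda) - 1) / (2 * lambda) +
    4 * Num.max 1 tau *
      sup [set opnorm (@rnorm R H) (T s) ^+ 2 | s in `[0, 1]]).

End form.

(* Main.v *)
Require Import Defs.
From HB Require Import structures.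
From mathcomp Require Import all_boot all_order all_algebra.
From mathcomp Require Import generic_quotient ring_quotient sesquilinear complex.
From mathcomp Require Import ring lra.
From mathcomp Require Import all_classical all_reals all_analysis.
From mathcomp Require Import measurable_realfun.

Import Order.TTheory GRing.Theory Num.Theory.
Import numFieldNormedType.Exports.

Local Open Scope classical_set_scope.
Local Open Scope complex_scope.
Local Open Scope ring_scope.

Set Implicit Arguments.
Unset Strict Implicit.
Unset Printing Implicit Defensive.

(** The norm is the quotient norm of the seminorm sqrt q on finitely supported
    functions f by the map f |-> endpoint f = sum_t T t (f t). Quotients of
    Hilbertian seminorms satisfy the parallelogram law, hence come from an inner
    product ([quotient_norm_parallelogram], [jordan_von_neumann]), so that three
    properties of q have to be shown.

    - Upper bound: h is the end point of the function equal to h at time 0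
      ([q_initial_le]).
    - Contractivity: delaying f by t multiplies its end point by T t and does not
      increase q. Indeed beta depends on differences of times only, and the weight
      exp (- 2 lambda r) in alpha absorbs the growth of T t in the first norm
      ([q_delay]).
    - Lower bound ([endpoint_le_q]): the end point h of f is the integral over
      [0, 2] of the trajectory of f plus the sum of (1 - c_t) T t (f t), where c_t
      is the length of the part of [t, t + 1] in [0, 2]. The integral is controlled
      by alpha, by Cauchy-Schwarz. In the second sum only times t >= 1 occur, hence
      T 1 factors out; as T 1 maps < , >_0 boundedly to the norm of H, it suffices
      to bound sum_t (1 - c_t) T (t - 1) (f t) in the seminorm of < , >_0.

    This last bound, and the positivity of beta, rest on the positive definiteness
    of the two-sided extension Phi0 of the contraction semigroup T0. The unitary
    dilation of T0 would give it; an induction on the times, from the latest to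
    the earliest, gives the inequality that is needed directly
    ([dilation_kernel_ge]). The multiplication of a positive kernel by the tent
    stays positive since the tent at (t, u) is the integral of the product of the
    indicators of [t, t + 1] and [u, u + 1], and Jensen's inequality for these
    integrals ([overlap_jensen]) compares c f with the tent part of beta.

    The seminorm < , >_0 is an average over a period: T s contracts it because the
    mean is translation invariant and T tau is a contraction
    ([mean_form_contraction]), and it dominates T 1 because the mean gives an arc
    of the circle at least its length ([rmean_arc], [rnorm_T1_le_mean_form]).

    Similarity of the semigroup to contractions requires an invertible A with
    |A h| equal to the new norm of h: a multiple of the square root of the Gram
    operator of the new inner product ([hilbertian_isometry]), built from Riesz
    representation and a fixed point iteration for the square root. *)

(** * Real parts of semidefinite Hermitian forms *)

Section real_forms.
Variables (R : realType) (V : lmodType R[i]).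
Implicit Types (b : V -> V -> R) (x y z : V).

(** The real part of a semidefinite Hermitian form, which determines the form.
    Invariance under multiplication by i replaces sesquilinearity over R[i], and
    all estimates below become inequalities between real numbers. *)
Record psd b : Prop := Psd {
  psdDl : forall x y z, b (x + y) z = b x z + b y z;
  psdC : forall x y, b x y = b y x;
  psdZl : forall (a : R) x y, b (a%:C *: x) y = a * b x y;
  psdii : forall x y, b ('i%C *: x) ('i%C *: y) = b x y;
  psd_ge0 : forall x, 0 <= b x x }.

Definition snorm b x : R := Num.sqrt (b x x).

Lemma scale_complexE (c : R[i]) x :
  c *: x = (complex.Re c)%:C *: x + (complex.Im c)%:C *: ('i%C *: x).
Proof. by rewrite scalerA -scalerDl {1}[c]complexE [_ * 'i%C]mulrC. Qed.

Section theory.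
Variables (b : V -> V -> R) (B : psd b).

Lemma psd0l x : b 0 x = 0.
Proof. by rewrite -(scale0r (0 : V)) -[0%R in X in b X]/((0 : R)%:C) psdZl// mul0r. Qed.

Lemma psdNl x y : b (- x) y = - b x y.
Proof. by apply/eqP; rewrite -addr_eq0 -psdDl// addNr psd0l. Qed.

Lemma psdDr x y z : b x (y + z) = b x y + b x z.
Proof. by rewrite psdC// psdDl// ![b _ x]psdC. Qed.

Lemma psdNr x y : b x (- y) = - b x y.
Proof. by rewrite psdC// psdNl// [b y x]psdC. Qed.

Lemma psd0r x : b x 0 = 0.
Proof. by rewrite psdC// psd0l. Qed.

Lemma psdZr (a : R) x y : b x (a%:C *: y) = a * b x y.
Proof. by rewrite psdC// psdZl// [b y x]psdC. Qed.

Lemma psd_suml I (s : seq I) (F : I -> V) y :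
  b (\sum_(i <- s) F i) y = \sum_(i <- s) b (F i) y.
Proof.
elim: s => [|i s IH]; first by rewrite !big_nil psd0l.
by rewrite !big_cons psdDl// IH.
Qed.

Lemma psd_sumr I (s : seq I) (F : I -> V) y :
  b y (\sum_(i <- s) F i) = \sum_(i <- s) b y (F i).
Proof.
by rewrite psdC// psd_suml; apply: eq_bigr => i _; rewrite psdC.
Qed.

Lemma psdZii (c : R[i]) x y : b (c *: x) y = b x ((c^*)%C *: y).
Proof.
have iN z w : b ('i%C *: z) w = - b z ('i%C *: w).
  by rewrite -psdii// scalerA -expr2 sqr_i scaleN1r psdNl.
rewrite (scale_complexE c) (scale_complexE _ y) psdDl// psdDr !psdZl// !psdZr//.
by case: c => a d /=; rewrite iN; ring.
Qed.

Lemma psdZZ (c : R[i]) x y :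
  b (c *: x) (c *: y) = (complex.Re `|c|) ^+ 2 * b x y.
Proof.
rewrite psdZii scalerA mulrC -sqr_normc.
have -> : `|c| ^+ 2 = ((complex.Re `|c|) ^+ 2)%:C.
  by rewrite normc_def rmorphXn.
by rewrite psdZr.
Qed.

Lemma snorm_ge0 x : 0 <= snorm b x.
Proof. exact: sqrtr_ge0. Qed.

Lemma sqr_snorm x : snorm b x ^+ 2 = b x x.
Proof. by rewrite sqr_sqrtr// psd_ge0. Qed.

Lemma snorm0 : snorm b 0 = 0.
Proof. by rewrite /snorm psd0l sqrtr0. Qed.

Lemma snormN x : snorm b (- x) = snorm b x.
Proof. by rewrite /snorm psdNl psdNr opprK. Qed.

Lemma snormZ (c : R[i]) x : snorm b (c *: x) = complex.Re `|c| * snorm b x.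
Proof.
rewrite /snorm psdZZ sqrtrM ?sqr_ge0// sqrtr_sqr ger0_norm//.
by have := normr_ge0 c; rewrite lecE /= => /andP[].
Qed.

Lemma psd_parallelogram x y :
  b (x + y) (x + y) + b (x - y) (x - y) = 2 * b x x + 2 * b y y.
Proof. by rewrite !psdDl// !psdDr !psdNl !psdNr; ring. Qed.

(** Minimize the nonnegative function t |-> b (x - t y) (x - t y); if b y y = 0
    this function is affine in t, hence constant. *)
Lemma psd_CS x y : b x y ^+ 2 <= b x x * b y y.
Proof.
have P (t : R) : 0 <= b x x - 2 * t * b x y + t ^+ 2 * b y y.
  have := psd_ge0 B (x - t%:C *: y).
  rewrite psdDl// !psdDr !psdNl !psdNr (psdZr t x y) !(psdZl B) (psdZr t y y) (psdC B y x).
  by lra.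
have := psd_ge0 B y; rewrite le_eqVlt => /orP[/eqP y0|ygt0].
  rewrite -y0 mulr0; move: P; rewrite -y0 => P.
  have [->|xy0] := eqVneq (b x y) 0; first by rewrite expr0n.
  have := P ((b x x + 1) / (2 * b x y)).
  suff -> : 2 * ((b x x + 1) / (2 * b x y)) * b x y = b x x + 1 by lra.
  by field.
have := P (b x y / b y y).
rewrite -(ler_pM2r ygt0) mul0r => h; rewrite -subr_ge0; move: h.
by congr (is_true (_ <= _)); field; exact: lt0r_neq0.
Qed.

Lemma psd_CS_norm x y : `|b x y| <= snorm b x * snorm b y.
Proof.
rewrite -sqrtr_sqr /snorm -sqrtrM ?psd_ge0//.
by apply: ler_wsqrtr; exact: psd_CS.
Qed.

Lemma ler_snormD x y : snorm b (x + y) <= snorm b x + snorm b y.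
Proof.
rewrite -(@ler_pXn2r _ 2)// ?nnegrE ?addr_ge0 ?snorm_ge0//.
rewrite sqrrD !sqr_snorm psdDl// !psdDr (psdC B y x).
have := le_trans (ler_norm _) (psd_CS_norm x y); lra.
Qed.

Lemma ler_snormB x y : snorm b (x - y) <= snorm b x + snorm b y.
Proof. by rewrite -(snormN y); exact: ler_snormD. Qed.

End theory.
End real_forms.

Lemma complex_ReD (R : rcfType) (x y : R[i]) : complex.Re (x + y) = complex.Re x + complex.Re y.
Proof. by case: x; case: y. Qed.

Lemma complex_ReZ (R : rcfType) (a : R) (y : R[i]) : complex.Re (a%:C * y) = a * complex.Re y.
Proof. by case: y => u v /=; rewrite mul0r subr0. Qed.

Section real_part_of_inner_product.
Variables (R : realType) (V : hilbertType R) (ip : inner_product V).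

Definition rip (x y : V) : R := complex.Re (ip x y).

Lemma ip_conj x y : ip x y = (ip y x)^*%C.
Proof. by rewrite (hermC ip) expr0 mul1r. Qed.

Lemma rip_psd : psd rip.
Proof.
split => [x y z|x y|a x y|x y|x]; rewrite /rip.
- by rewrite linearDl complex_ReD.
- by rewrite ip_conj; case: (ip y x).
- by rewrite linearZl_LR /=; case: (ip x y) => ? ? /=; rewrite mul0r subr0.
- rewrite linearZl_LR linearZr_LR /=; case: (ip x y) => u v /=; simpc; ring.
- have [->|x0] := eqVneq x 0; first by rewrite linear0l.
  by have := neq0_dnorm_gt0 (s := ip) x x0; rewrite ltcE => /andP[_ /ltW].
Qed.

Lemma sqr_ipnorm x : ipnorm ip x ^+ 2 = rip x x.
Proof. exact: sqr_snorm rip_psd x. Qed.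

End real_part_of_inner_product.

(** * Bounded operators on a Hilbert space *)

Section hilbert.
Variables (R : realType) (H : hilbertType R).
Implicit Types (h k x y : H).

Local Notation "<< x , y >>" := (rip (@inner R H) x y).
Local Notation B := (rip_psd (@inner R H)).

Lemma rnormE h : rnorm h = snorm (rip (@inner R H)) h.
Proof.
rewrite /snorm /rip -norm_inner /rnorm.
have := normr_ge0 h; rewrite lecE /= => /andP[].
case: `|h| => u v /= /eqP-> u0; rewrite mulr0 subr0.
by rewrite -expr2 sqrtr_sqr ger0_norm.
Qed.

Lemma normE h : `|h| = (rnorm h)%:C.
Proof.
rewrite /rnorm; have := normr_ge0 h; rewrite lecE /= => /andP[].
by case: `|h| => u v /= /eqP->.
Qed.

Lemma sqr_rnorm h : rnorm h ^+ 2 = << h, h >>.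
Proof. by rewrite rnormE (sqr_snorm B). Qed.

Lemma rnorm_ge0 h : 0 <= rnorm h.
Proof. by rewrite rnormE snorm_ge0. Qed.

Lemma rnorm0 : rnorm (0 : H) = 0.
Proof. by rewrite rnormE (snorm0 B). Qed.

Lemma rnormN h : rnorm (- h) = rnorm h.
Proof. by rewrite !rnormE (snormN B). Qed.

Lemma rnormZ (c : R[i]) h : rnorm (c *: h) = complex.Re `|c| * rnorm h.
Proof. by rewrite !rnormE (snormZ B). Qed.

Lemma rnormZr (c : R) h : rnorm (c%:C *: h) = `|c| * rnorm h.
Proof. by rewrite rnormZ normc_def /= expr0n addr0 sqrtr_sqr. Qed.

Lemma ler_rnormD x y : rnorm (x + y) <= rnorm x + rnorm y.
Proof. by rewrite !rnormE (ler_snormD B). Qed.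

Lemma ler_rnormB x y : rnorm (x - y) <= rnorm x + rnorm y.
Proof. by rewrite !rnormE (ler_snormB B). Qed.

Lemma rnorm_distC x y : rnorm (x - y) = rnorm (y - x).
Proof. by rewrite -rnormN opprB. Qed.

Lemma ler_rnorm_dist y x z : rnorm (x - z) <= rnorm (x - y) + rnorm (y - z).
Proof. by apply: le_trans (ler_rnormD _ _); rewrite addrA subrK. Qed.

Lemma rnorm_eq0 h : rnorm h = 0 -> h = 0.
Proof. by move=> h0; apply/normr0_eq0; rewrite normE h0. Qed.

Lemma rip_CS x y : `|<< x, y >>| <= rnorm x * rnorm y.
Proof. by rewrite !rnormE; exact: psd_CS_norm B _ _. Qed.

(** Convergence in norm with real radii; the norm of H itself has values in R[i]. *)
Definition rcvg (u : nat -> H) l := forall e : R, 0 < e ->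
  exists N, forall n, (N <= n)%N -> rnorm (u n - l) < e.

Lemma rcauchy_cvg (u : nat -> H) :
  (forall e : R, 0 < e -> exists N, forall n, (N <= n)%N -> rnorm (u n - u N) < e) ->
  exists l, rcvg u l.
Proof.
move=> Cu.
have realE (e : R[i]) : 0 < e -> exists2 a : R, e = a%:C & 0 < a.
  by case: e => a b; rewrite ltcE /= => /andP[/eqP-> a0]; exists a.
have : cvg (u @ \oo).
  apply/cauchy_cvgP; apply: cauchy_exP => _ /realE[e -> e0].
  have [N uN] := Cu _ e0; exists (u N); exists N => // n /= Nn.
  by rewrite -ball_normE /= distrC normE ltcR uN.
move=> /cvg_ex[l ul]; exists l => e e0.
move/cvgrPdist_lt : ul => /(_ e%:C); rewrite ltcR => /(_ e0)[N _ uN].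
exists N => n Nn; have := uN n Nn.
by rewrite /= distrC normE ltcR.
Qed.

End hilbert.

Section bounded_operators.
Variables (R : realType) (H K : hilbertType R).

Lemma continuous_boundedP (A : {linear H -> K}) : continuous A <->
  exists2 C, 0 <= C & forall h, rnorm (A h) <= C * rnorm h.
Proof.
split.
  move=> /linear_bounded_continuous /linear_boundedP /pinfty_ex_gt0[[C C']].
  rewrite ltcE /= => /andP[/eqP -> C0] AC; exists C; first exact: ltW.
  by move=> h; have := AC h; rewrite -[Complex C 0]/(C%:C) !normE -rmorphM lecR.
move=> [C C0 AC]; apply/linear_bounded_continuous/linear_boundedP.
near=> r => x; apply: (@le_trans _ _ (C%:C * `|x|)).
  by rewrite !normE -rmorphM lecR.
rewrite ler_wpM2r//; near: r; apply: nbhs_pinfty_ge.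
by rewrite realE ler0c C0.
Unshelve. all: by end_near. Qed.

End bounded_operators.

Section operator_norm.
Variables (R : realType) (H : hilbertType R) (b : H -> H -> R) (B : psd b).


Lemma opnorm_le (A : H -> H) C : 0 <= C -> (forall h, snorm b (A h) <= C * snorm b h) ->
  opnorm (snorm b) A <= C.
Proof.
move=> C0 AC; apply: ge_sup.
  by exists (snorm b (A 0)), 0 => //=; rewrite (snorm0 B) ler01.
move=> _ [h /= h1 <-]; apply: le_trans (AC h) _.
by rewrite -[leRHS]mulr1 ler_wpM2l.
Qed.

(** A vector of seminorm 0 cannot be normalized, but its image has seminorm 0
    because A is bounded. *)
Lemma opnorm_bound (A : {linear H -> H}) C : 0 <= C -> (forall h, snorm b (A h) <= C * snorm b h) ->
  0 <= opnorm (snorm b) A /\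
  forall h, snorm b (A h) <= opnorm (snorm b) A * snorm b h.
Proof.
move=> C0 AC.
have ub h : snorm b h <= 1 -> snorm b (A h) <= opnorm (snorm b) A.
  move=> h1; apply: ub_le_sup; last by exists h.
  exists C => _ [k /= k1 <-]; apply: le_trans (AC k) _.
  by rewrite -[leRHS]mulr1 ler_wpM2l.
split; first by apply: le_trans (ub 0 _); rewrite ?snorm_ge0 ?(snorm0 B).
move=> h; have := snorm_ge0 b h; rewrite le_eqVlt => /orP[/eqP h0|h0].
  by have := AC h; rewrite -h0 !mulr0.
have nV : complex.Re `|((snorm b h)^-1)%:C| = (snorm b h)^-1.
  rewrite normc_def /= expr0n addr0 sqrtr_sqr ger0_norm// invr_ge0.
  exact: ltW.
have := ub (((snorm b h)^-1)%:C *: h).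
rewrite linearZ /= !(snormZ B) nV mulVf ?gt_eqF// lexx => /(_ isT).
by rewrite ler_pdivrMl// mulrC.
Qed.

End operator_norm.

Lemma rnorm_opnorm_le (R : realType) (H : hilbertType R) (A : H -> H) (C : R) : 0 <= C ->
  (forall h, rnorm (A h) <= C * rnorm h) -> opnorm (@rnorm R H) A <= C.
Proof.
have -> : @rnorm R H = snorm (rip (@inner R H)) by apply/funext => h; rewrite rnormE.
exact: (opnorm_le (rip_psd (@inner R H))).
Qed.

(** * Riesz representation and geometric convergence *)

Section riesz_representation.
Variables (R : realType) (H : hilbertType R).
Implicit Types (h k x y : H).

Local Notation "<< x , y >>" := (rip (@inner R H) x y).
Local Notation B := (rip_psd (@inner R H)).

(** The functional is represented by the minimizer of J k = |k|^2 - 2 phi k. By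
    the parallelogram law minimizing sequences are Cauchy; the first variation of
    J at an almost minimizer is small, and it tends to << g, k >> - phi k. *)
Lemma riesz (phi : H -> R) (K : R) : 0 <= K ->
  (forall x y, phi (x + y) = phi x + phi y) ->
  (forall (a : R) x, phi (a%:C *: x) = a * phi x) ->
  (forall x, `|phi x| <= K * rnorm x) ->
  exists g, forall k, phi k = << g, k >>.
Proof.
move=> K0 phiD phiZ phiK.
pose J k := << k, k >> - 2 * phi k.
pose d := inf (range J).
have Jlb k : - K ^+ 2 <= J k.
  have := le_trans (ler_norm _) (phiK k); rewrite /J -sqr_rnorm.
  have := sqr_ge0 (rnorm k - K); nra.
have hinf : has_inf (range J).
  by split; [exists (J 0), 0 | exists (- K ^+ 2) => _ [k _ <-]].
have dJ k : d <= J k by apply: ge_inf; [case: hinf | exists k].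
have /choice[u Ju] : forall n : nat, exists v, J v < d + n.+1%:R^-1.
  move=> n; have [_ [k _ <-] kd] := inf_adherent (E := range J) (eps := n.+1%:R^-1)
    (ltac:(by rewrite invr_gt0 ltr0n)) hinf.
  by exists k.
have par n m : rnorm (u n - u m) ^+ 2 <= 2 * n.+1%:R^-1 + 2 * m.+1%:R^-1.
  have := psd_parallelogram B (u n) (u m).
  have := dJ ((2^-1)%:C *: (u n + u m)); have := Ju n; have := Ju m.
  rewrite sqr_rnorm /J phiZ phiD (psdZl B) (psdZr B).
  move: (n.+1%:R^-1) (m.+1%:R^-1) => en em. lra.
have inv_small (e : R) : 0 < e -> exists N, forall n, (N <= n)%N -> n.+1%:R^-1 < e.
  move=> e0; exists (Num.truncn e^-1) => n Nn.
  rewrite invf_plt ?posrE ?ltr0n//.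
  by apply: lt_le_trans (truncnS_gt _) _; rewrite ler_nat.
have [g ug] : exists g, rcvg u g.
  apply: rcauchy_cvg => e e0.
  have [N uN] := inv_small (e ^+ 2 / 4) (ltac:(by rewrite divr_gt0 ?exprn_gt0)).
  exists N => n Nn.
  rewrite -(@ltr_pXn2r _ 2)// ?nnegrE ?rnorm_ge0 ?(ltW e0)//.
  by have := uN n Nn; have := uN N (leqnn N); have := par n N;
  move: (n.+1%:R^-1) (N.+1%:R^-1) => en em; lra.
exists g => k.
have key n : (<< u n, k >> - phi k) ^+ 2 <= n.+1%:R^-1 * (<< k, k >> + 1).
  have kk := psd_ge0 B k.
  (* the minimizer over t of J (u n + t k), up to the 1 that allows k = 0 *)
  pose t := - (<< u n, k >> - phi k) / (<< k, k >> + 1).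
  have := dJ (u n + t%:C *: k); have := Ju n.
  rewrite /J phiD phiZ (psdDl B) !(psdDr B) !(psdZl B) !(psdZr B) (psdC B k).
  set dl := << u n, k >> - phi k => h1 h2.
  move: h1 h2; move: (n.+1%:R^-1) => en h1 h2.
  have {h1 h2} : 0 <= en + 2 * t * dl + t ^+ 2 * << k, k >>.
    by rewrite /dl; lra.
  have -> : dl = - t * (<< k, k >> + 1) by rewrite /t -/dl; field; rewrite gt_eqF//; lra.
  have : 0 <= t ^+ 2 by exact: sqr_ge0.
  have : 0 < << k, k >> + 1 by lra.
  set v := << k, k >> + 1; rewrite (_ : << k, k >> = v - 1); last by rewrite /v; ring.
  by move=> v0 t0; nra.
apply/eqP; rewrite -subr_eq0 -normr_le0; apply/ler_addgt0Pl => e e0.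
rewrite addr0.
pose M := rnorm k + 1; have M0 : 0 < M by rewrite ltr_wpDl ?rnorm_ge0.
have [N1 uN1] := ug (e / (2 * M)) (ltac:(by rewrite divr_gt0 ?mulr_gt0)).
have B1 : 0 < << k, k >> + 1 by rewrite ltr_wpDl ?(psd_ge0 B).
have [N2 uN2] := inv_small ((e / 2) ^+ 2 / (<< k, k >> + 1))
  (ltac:(by rewrite divr_gt0 ?exprn_gt0 ?divr_gt0)).
pose n := maxn N1 N2.
have -> : phi k - << g, k >> = << u n - g, k >> - (<< u n, k >> - phi k).
  by rewrite (psdDl B) (psdNl B); ring.
apply: (le_trans (ler_normB _ _)).
have h1 : `|<< u n - g, k >>| <= e / 2.
  apply: le_trans (rip_CS _ _) _.
  have := uN1 n (leq_maxl _ _); rewrite ltr_pdivlMr ?mulr_gt0//.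
  have := rnorm_ge0 (u n - g); have := rnorm_ge0 k; rewrite /M; nra.
have h2 : `|<< u n, k >> - phi k| <= e / 2.
  rewrite -(@ler_pXn2r _ 2)// ?nnegrE ?divr_ge0 ?(ltW e0)// real_normK ?num_real//.
  apply: le_trans (key n) _.
  by have := uN2 n (leq_maxr _ _); rewrite ltr_pdivlMr// => /ltW.
by apply: le_trans (lerD h1 h2) _; rewrite -splitr.
Qed.

(** Riesz representation in each left argument. Semidefiniteness turns the bound
    on the diagonal of x into the same bound on the operator norm, by
    Cauchy-Schwarz for the form x itself. *)
Lemma form_operator (x : H -> H -> R) (q : R) : psd x -> 0 <= q ->
  (forall h, x h h <= q * << h, h >>) ->
  exists X : {linear H -> H},
    (forall h k, << X h, k >> = x h k) /\ forall h, rnorm (X h) <= q * rnorm h.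
Proof.
move=> P q0 xq.
have xCS h k : `|x h k| <= q * rnorm h * rnorm k.
  rewrite -(@ler_pXn2r _ 2)// ?nnegrE ?mulr_ge0 ?rnorm_ge0// real_normK ?num_real//.
  apply: le_trans (psd_CS P h k) _.
  rewrite !exprMn !sqr_rnorm.
  have := ler_pM (psd_ge0 P h) (psd_ge0 P k) (xq h) (xq k); lra.
have /choice[X xX] : forall h, exists g, forall k, x h k = << g, k >>.
  move=> h; apply: (@riesz (x h) (q * rnorm h)); first by rewrite mulr_ge0 ?rnorm_ge0.
  - by move=> *; rewrite (psdDr P).
  - by move=> *; rewrite (psdZr P).
  - exact: xCS.
have eqX u v : (forall k, << u, k >> = << v, k >>) -> u = v.
  move=> uv; apply/eqP; rewrite -subr_eq0; apply/eqP/rnorm_eq0/eqP.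
  by rewrite -sqrf_eq0 sqr_rnorm (psdDl B) (psdNl B) uv subrr.
have linX : linear X.
  move=> a u v; apply: eqX => k.
  rewrite -xX (psdDl P) (psdZii P) (psdDl B) (psdZii B).
  by rewrite !xX.
pose Xm := HB.pack_for {linear H -> H} X (GRing.isLinear.Build _ _ _ _ X linX).
exists Xm; split=> [h k|h]; first by rewrite xX.
have [Xh0|Xh0] := eqVneq (rnorm (X h)) 0.
  by rewrite /= Xh0 mulr_ge0 ?rnorm_ge0.
rewrite -(@ler_pM2r _ (rnorm (X h))) ?lt_def ?Xh0 ?rnorm_ge0//=.
by rewrite -expr2 sqr_rnorm -xX; apply: le_trans (ler_norm _) (xCS _ _).
Qed.

Lemma expr_small (p e : R) : 0 <= p < 1 -> 0 < e ->
  exists N, forall n, (N <= n)%N -> p ^+ n < e.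
Proof.
move=> /andP[p0 p1] e0.
have /cvgrPdist_lt/(_ e e0)[N _ pN] : (fun n => p ^+ n) @ \oo --> (0 : R).
  by apply: cvg_expr; rewrite ger0_norm.
exists N => n Nn; have := pN n Nn.
by rewrite /= sub0r normrN ger0_norm// exprn_ge0.
Qed.

(** Identities between limits of geometrically convergent sequences are proved by
    bounding the norm of the difference of the two sides this way. *)
Lemma le0_geometric (a C p : R) : 0 <= p < 1 -> 0 <= C ->
  (forall n, a <= C * p ^+ n) -> a <= 0.
Proof.
move=> p01 C0 aC; apply/ler_addgt0Pl => e e0; rewrite addr0.
have C1 : 0 < C + 1 by rewrite ltr_wpDl.
have [N pN] := expr_small p01 (divr_gt0 e0 C1).
apply: le_trans (aC N) _; have := pN N (leqnn N).
rewrite ltr_pdivlMr//; have : 0 <= p ^+ N by rewrite exprn_ge0 //; case/andP: p01.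
nra.
Qed.

Lemma geometric_cvg (u : nat -> H) (K p : R) : 0 <= p < 1 -> 0 <= K ->
  (forall n, rnorm (u n.+1 - u n) <= K * p ^+ n) ->
  exists l, forall n, rnorm (u n - l) <= K / (1 - p) * p ^+ n.
Proof.
move=> p01 K0 uK; have /andP[p0 p1] := p01.
have q0 : 0 < 1 - p by lra.
have K'0 : 0 <= K / (1 - p) by rewrite divr_ge0// ltW.
have inc n m : rnorm (u (m + n)%N - u n) <= K / (1 - p) * p ^+ n * (1 - p ^+ m).
  elim: m => [|m IH]; first by rewrite add0n !subrr rnorm0 mulr0.
  apply: le_trans (ler_rnorm_dist (u (m + n)%N) _ _) _.
  apply: le_trans (lerD (uK _) IH) _.
  rewrite exprS exprD le_eqVlt; apply/orP; left; apply/eqP.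
  by field; lra.
have inc' n m : rnorm (u (m + n)%N - u n) <= K / (1 - p) * p ^+ n.
  apply: le_trans (inc n m) _; rewrite -[leRHS]mulr1 ler_wpM2l//.
    by rewrite mulr_ge0// exprn_ge0.
  by rewrite gerBl exprn_ge0.
have [l ul] : exists l, rcvg u l.
  apply: rcauchy_cvg => e e0.
  have C1 : 0 < K / (1 - p) + 1 by rewrite ltr_wpDl.
  have [N pN] := expr_small p01 (divr_gt0 e0 C1).
  exists N => n Nn; rewrite -(subnK Nn).
  apply: le_lt_trans (inc' _ _) _.
  have := pN N (leqnn N); rewrite ltr_pdivlMr//.
  have : 0 <= p ^+ N by rewrite exprn_ge0.
  set A := K / _; nra.
exists l => n; apply/ler_addgt0Pl => e e0.
have [N uN] := ul e e0.
apply: le_trans (ler_rnorm_dist (u (N + n)%N) _ _) _.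
rewrite addrC lerD//; first by apply/ltW/uN; rewrite leq_addr.
by rewrite rnorm_distC inc'.
Qed.

End riesz_representation.

(** * Square roots of operators *)

Section square_root.
Variables (R : realType) (H : hilbertType R).
Implicit Types (h k x y : H).

Local Notation "<< x , y >>" := (rip (@inner R H) x y).
Local Notation B := (rip_psd (@inner R H)).

(** The equation for Y says that (I - Y)^2 = I - X, so that I - Y is a square root
    of I - X. The map Y |-> (X + Y^2) / 2 preserves the operators of norm at most
    p and contracts them with ratio p, where p = (q + p^2) / 2; its Picard
    iterates from 0 are self-adjoint and converge pointwise at a geometric rate.
    Positivity of the root is not asserted, only |Y| <= p < 1. *)
Lemma square_root_fixpoint (X : {linear H -> H}) (q : R) : 0 <= q < 1 ->
  (forall h k, << X h, k >> = << h, X k >>) ->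
  (forall h, rnorm (X h) <= q * rnorm h) ->
  exists (Y : {linear H -> H}) (p : R), [/\ 0 <= p < 1,
    forall h, rnorm (Y h) <= p * rnorm h,
    forall h k, << Y h, k >> = << h, Y k >>
    & forall h, Y h = (2^-1)%:C *: (X h + Y (Y h))].
Proof.
move=> /andP[q0 q1] Xadj Xq.
(* the smaller solution of p = (q + p ^ 2) / 2 *)
pose r := Num.sqrt (1 - q); pose p := 1 - r.
have r2 : r ^+ 2 = 1 - q by rewrite sqr_sqrtr//; lra.
have r0 : 0 < r by rewrite sqrtr_gt0; lra.
have r1 : r <= 1 by rewrite -(@ler_pXn2r _ 2)// ?nnegrE ?(ltW r0)// expr1n r2; lra.
have p01 : 0 <= p < 1 by rewrite /p; lra.
have /andP[p0 p1] := p01.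
have pfix : q + p ^+ 2 = 2 * p by rewrite /p; have := r2; nra.
have rhalf h : rnorm ((2^-1)%:C *: h) = 2^-1 * rnorm h.
  by rewrite rnormZr ger0_norm// invr_ge0.
pose Y := fix Y n := if n is n'.+1
  then fun h : H => (2^-1)%:C *: (X h + Y n' (Y n' h)) else fun=> 0.
have YS n h : Y n.+1 h = (2^-1)%:C *: (X h + Y n (Y n h)) by [].
have Ylin n : linear (Y n).
  elim: n => [|n IH] a u v; first by rewrite /= scaler0 addr0.
  rewrite !YS !IH linearP [a *: (_ *: _)]scalerA [a * _]mulrC.
  rewrite -[X in _ = X + _]scalerA -scalerDr.
  by congr (_ *: _); rewrite scalerDr addrACA.
have YB n u v : Y n (u - v) = Y n u - Y n v.
  by rewrite addrC -scaleN1r Ylin scaleN1r addrC.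
have Yp n h : rnorm (Y n h) <= p * rnorm h.
  elim: n h => [|n IH] h; first by rewrite /= rnorm0 mulr_ge0// rnorm_ge0.
  rewrite YS rhalf.
  have := ler_rnormD (X h) (Y n (Y n h)); have := Xq h; have := IH h.
  have := IH (Y n h); have := rnorm_ge0 h; have := pfix.
  nra.
have Ystep n h : rnorm (Y n.+1 h - Y n h) <= rnorm h * p ^+ n.
  elim: n h => [|n IH] h.
    rewrite YS /= !(addr0, subr0) rhalf expr0.
    by have := Xq h; have := rnorm_ge0 h; nra.
  have -> : Y n.+2 h - Y n.+1 h = (2^-1)%:C *: (Y n.+1 (Y n.+1 h) - Y n (Y n h)).
    by rewrite (YS n.+1) [X in _ - X]YS -scalerBr opprD addrACA subrr add0r.
  rewrite rhalf.
  have := ler_rnorm_dist (Y n.+1 (Y n h)) (Y n.+1 (Y n.+1 h)) (Y n (Y n h)).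
  rewrite -YB; have := Yp n.+1 (Y n.+1 h - Y n h); have := IH h.
  have := IH (Y n h); have := Yp n h; rewrite exprS.
  have := exprn_ge0 n p0; move: (p ^+ n) => pn; have := rnorm_ge0 h.
  have := rnorm_ge0 (Y n h); have := rnorm_ge0 (Y n.+1 h - Y n h).
  move=> *; nra.
have q0' : 0 < 1 - p by lra.
pose c := (1 - p)^-1; have c0 : 0 <= c by rewrite invr_ge0 ltW.
have /choice[Z ZY] : forall h, exists l, forall n,
    rnorm (Y n h - l) <= c * rnorm h * p ^+ n.
  move=> h; have [l Hl] := geometric_cvg p01 (rnorm_ge0 h) (Ystep^~ h).
  by exists l => n; rewrite [c * _]mulrC; exact: Hl.
have lim0 x C : 0 <= C -> (forall n, rnorm x <= C * p ^+ n) -> x = 0.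
  move=> C0 xC; apply/rnorm_eq0/eqP; rewrite eq_le rnorm_ge0 andbT.
  exact: le0_geometric p01 C0 xC.
have Zlin : linear Z.
  move=> a u v; apply/eqP; rewrite -subr_eq0; apply/eqP.
  pose C := c * rnorm (a *: u + v) + complex.Re `|a| * (c * rnorm u) + c * rnorm v.
  have a0 : 0 <= complex.Re `|a| by have := normr_ge0 a; rewrite lecE => /andP[].
  apply: (lim0 _ C) => [|n]; first by rewrite !addr_ge0 ?mulr_ge0 ?rnorm_ge0.
  have -> : Z (a *: u + v) - (a *: Z u + Z v) =
      (Z (a *: u + v) - Y n (a *: u + v)) + (a *: (Y n u - Z u) + (Y n v - Z v)).
    by rewrite Ylin scalerBr [X in _ = _ + X]addrACA -opprD addrA subrK.
  apply: le_trans (ler_rnormD _ _) _; rewrite rnorm_distC /C !mulrDl -!addrA.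
  apply: lerD (ZY _ _) _.
  apply: le_trans (ler_rnormD _ _) _; rewrite rnormZ -mulrA.
  by apply: lerD (ZY _ _); rewrite ler_wpM2l// ZY.
pose Zm := HB.pack_for {linear H -> H} Z (GRing.isLinear.Build _ _ _ _ Z Zlin).
exists Zm, p; split => //= [h|h k|h].
- rewrite -subr_le0; apply: (le0_geometric p01 (_ : 0 <= c * rnorm h)).
    by rewrite mulr_ge0 ?rnorm_ge0.
  move=> n; rewrite lerBlDl.
  have := ler_rnormB (Y n h) (Y n h - Z h); rewrite opprB addrC subrK => h1.
  by apply: le_trans h1 (lerD (Yp _ _) (ZY _ _)).
- have Yadj n u v : << Y n u, v >> = << u, Y n v >>.
    elim: n u v => [|n IH] u v; first by rewrite (psd0l B) (psd0r B).
    by rewrite !YS (psdZl B) (psdZr B) (psdDl B) (psdDr B) Xadj !IH.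
  apply/eqP; rewrite -subr_eq0 -normr_le0.
  apply: (le0_geometric p01 (_ : 0 <= 2 * c * rnorm h * rnorm k)).
    by rewrite !mulr_ge0 ?rnorm_ge0.
  move=> n.
  have -> : << Z h, k >> - << h, Z k >> =
      << h, Y n k - Z k >> - << Y n h - Z h, k >>.
    by rewrite (psdDl B) (psdDr B) (psdNl B) (psdNr B) Yadj; ring.
  apply: le_trans (ler_normB _ _) _.
  apply: le_trans (lerD (rip_CS _ _) (rip_CS _ _)) _.
  have := ler_wpM2l (rnorm_ge0 h) (ZY k n).
  have := ler_wpM2r (rnorm_ge0 k) (ZY h n).
  by lra.
- apply/eqP; rewrite -subr_eq0; apply/eqP.
  apply: (lim0 _ (c * rnorm h + c * rnorm h + c * rnorm (Z h))) => [|n].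
    by rewrite !addr_ge0 ?mulr_ge0 ?rnorm_ge0.
  have -> : Z h - (2^-1)%:C *: (X h + Z (Z h)) = (Z h - Y n.+1 h) +
      (2^-1)%:C *: (Y n (Y n h - Z h) + (Y n (Z h) - Z (Z h))).
    rewrite YB subrKA YS.
    have -> : Y n (Y n h) - Z (Z h) = X h + Y n (Y n h) - (X h + Z (Z h)).
      by rewrite opprD addrACA subrr add0r.
    by rewrite scalerBr addrA subrK.
  apply: le_trans (ler_rnormD _ _) _; rewrite rnorm_distC rhalf.
  have := ler_rnormD (Y n (Y n h - Z h)) (Y n (Z h) - Z (Z h)).
  have := Yp n (Y n h - Z h); have := ZY h n; have := ZY h n.+1; have := ZY (Z h) n.
  rewrite exprS; have := rnorm_ge0 (Y n h - Z h).
  have : 0 <= c * rnorm h * p ^+ n by rewrite !mulr_ge0 ?rnorm_ge0 ?exprn_ge0.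
  have : 0 <= c * rnorm (Z h) * p ^+ n by rewrite !mulr_ge0 ?rnorm_ge0 ?exprn_ge0.
  set a1 := c * rnorm h; set a2 := c * rnorm (Z h); move: (p ^+ n) => pn.
  move=> h1 h2 h3 h4 h5 h6 h7 h8.
  have : a1 * (p * pn) <= a1 * pn by rewrite mulrCA -[leRHS]mul1r ler_wpM2r// ltW.
  have : p * rnorm (Y n h - Z h) <= rnorm (Y n h - Z h).
    by rewrite -[leRHS]mul1r ler_wpM2r// ltW.
  lra.
Qed.
End square_root.

(** * Isometries onto an equivalent Hilbertian norm *)

Section isometry.
Variables (R : realType) (H : hilbertType R).
Implicit Types (h k x y : H).

Local Notation "<< x , y >>" := (rip (@inner R H) x y).
Local Notation B := (rip_psd (@inner R H)).

(** Picard iteration for x = z + Y x, that is, the Neumann series of Y at z. *)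
Lemma neumann_solution (Y : {linear H -> H}) (p : R) : 0 <= p < 1 ->
  (forall h, rnorm (Y h) <= p * rnorm h) -> forall z, exists x, x - Y x = z.
Proof.
move=> p01 Yp z; have /andP[p0 p1] := p01.
pose u := fix u n := if n is n'.+1 then z + Y (u n') else z.
have step n : rnorm (u n.+1 - u n) <= rnorm z * p ^+ n.
  elim: n => [|n IH].
    rewrite /= addrC addKr expr0; have := Yp z; have := rnorm_ge0 z; nra.
  rewrite [u n.+2]/(z + Y (u n.+1)) {2}[u n.+1]/(z + Y (u n)).
  rewrite opprD addrACA subrr add0r -linearB exprS.
  by apply: le_trans (Yp _) _; rewrite mulrCA ler_wpM2l.
have [x ux] := geometric_cvg p01 (rnorm_ge0 z) step.
exists x; apply/eqP; rewrite -subr_eq0; apply/eqP/rnorm_eq0/eqP.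
rewrite eq_le rnorm_ge0 andbT.
have c0 : 0 <= rnorm z / (1 - p) by rewrite divr_ge0 ?rnorm_ge0//; lra.
apply: (le0_geometric p01 (_ : 0 <= 2 * (rnorm z / (1 - p)))); first exact: mulr_ge0.
move=> n.
have -> : x - Y x - z = Y (u n - x) - (u n.+1 - x).
  by rewrite linearB /= opprB [RHS]addrC opprD [X in _ = X + _]addrA subrKA addrAC.
apply: le_trans (ler_rnormB _ _) _.
have := Yp (u n - x); have := ux n; have := ux n.+1; rewrite exprS.
have : 0 <= rnorm z / (1 - p) * p ^+ n by rewrite mulr_ge0// exprn_ge0.
have := rnorm_ge0 (u n - x); move: (rnorm z / (1 - p)) (p ^+ n) => a b.
nra.
Qed.

(** Write ip h k = C^2 <(I - X) h, k> with 0 <= X <= q < 1 and take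
    A = C (I - Y), where (I - Y)^2 = I - X. As A is self-adjoint, the square of
    |A h| is <A^2 h, h> = ip h h, and A is onto by the Neumann series of Y. *)
Lemma hilbertian_isometry (ip : inner_product H) (c C : R) : 0 < c -> 0 < C ->
  (forall h, c * rnorm h <= ipnorm ip h <= C * rnorm h) ->
  exists A A' : {linear H -> H},
    [/\ cancel A A', cancel A' A & forall h, rnorm (A h) = ipnorm ip h].
Proof.
move=> c0 C0 cC.
(* the minimum matters only if H = {0}: otherwise c <= C *)
pose d := Num.min c C / C; pose q := 1 - d ^+ 2.
have d0 : 0 < d by rewrite divr_gt0// lt_min c0.
have d1 : d <= 1 by rewrite ler_pdivrMr// mul1r ge_min lexx orbT.
have q01 : 0 <= q < 1 by rewrite /q; nra.
have /andP[q0 _] := q01.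
have up h : (C ^+ 2)^-1 * rip ip h h <= << h, h >>.
  have /andP[_ h2] := cC h.
  rewrite ler_pdivrMl ?exprn_gt0// -(sqr_ipnorm ip) -sqr_rnorm -exprMn.
  by rewrite ler_pXn2r ?nnegrE ?mulr_ge0 ?sqrtr_ge0 ?rnorm_ge0 ?(ltW C0).
have lo h : d ^+ 2 * << h, h >> <= (C ^+ 2)^-1 * rip ip h h.
  have /andP[h1 _] := cC h.
  rewrite ler_pdivlMl ?exprn_gt0// -(sqr_ipnorm ip) -sqr_rnorm -!exprMn.
  rewrite ler_pXn2r ?nnegrE ?sqrtr_ge0//; last first.
    exact: mulr_ge0 (ltW C0) (mulr_ge0 (ltW d0) (rnorm_ge0 h)).
  apply: le_trans h1; rewrite mulrA; apply: ler_wpM2r; first exact: rnorm_ge0.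
  by rewrite /d mulrC divfK ?gt_eqF// ge_min lexx.
pose x h k := << h, k >> - (C ^+ 2)^-1 * rip ip h k.
have P := rip_psd ip.
have px : psd x.
  split => [u v w|u v|a u v|u v|u]; rewrite /x.
  - by rewrite (psdDl B) (psdDl P); ring.
  - by rewrite (psdC B) (psdC P).
  - by rewrite (psdZl B) (psdZl P); ring.
  - by rewrite (psdii B) (psdii P).
  - by rewrite subr_ge0.
have [|X [Xx Xq]] := form_operator px q0.
  by move=> h; rewrite /x /q; have := lo h; lra.
have Xadj h k : << X h, k >> = << h, X k >>.
  by rewrite Xx [RHS](psdC B) Xx (psdC px).
have [Y [p [p01 Yp Yadj Yfix]]] := square_root_fixpoint q01 Xadj Xq.
pose A h := C%:C *: (h - Y h).
have linA : linear A.
  move=> a u v; rewrite /A linearP opprD addrACA -scalerBr scalerDr.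
  by rewrite !scalerA mulrC.
pose Am := HB.pack_for {linear H -> H} A (GRing.isLinear.Build _ _ _ _ A linA).
have AN h : rnorm (A h) = ipnorm ip h.
  apply/eqP; rewrite -(@eqrXn2 _ 2) ?rnorm_ge0 ?sqrtr_ge0// sqr_ipnorm sqr_rnorm.
  rewrite /A (psdZl B) (psdZr B) (psdDl B) !(psdDr B) !(psdNl B) !(psdNr B).
  rewrite (psdC B h (Y h)) -[<< Y h, Y h>>]Yadj.
  have := Xx h h; rewrite /x => Xhh.
  have : 2 * << Y h, h >> = << X h, h >> + << Y (Y h), h >>.
    by rewrite {1}Yfix (psdZl B) (psdDl B); lra.
  move=> e; apply/eqP.
  suff -> : rip ip h h = C ^+ 2 * (<< h, h >> - << X h, h >>) by nra.
  by rewrite Xhh; field; rewrite gt_eqF.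
have injA u v : A u = A v -> u = v.
  move=> uv; apply/eqP; rewrite -subr_eq0; apply/eqP/rnorm_eq0/eqP.
  have : ipnorm ip (u - v) = 0.
    by rewrite -AN -[A _]/(Am _) linearB /= uv subrr rnorm0.
  have /andP[h1 _] := cC (u - v); move=> h2; rewrite h2 in h1.
  by rewrite eq_le rnorm_ge0 andbT -(ler_pM2l c0) mulr0.
have /choice[A' AA'] : forall z, exists w, A w = z.
  move=> z; have [w wz] := neumann_solution p01 Yp ((C^-1)%:C *: z).
  exists w; rewrite /A wz scalerA -rmorphM divff ?gt_eqF//.
  by rewrite rmorph1 scale1r.
have linA' : linear A' by move=> a u v; apply: injA; rewrite linA !AA'.
pose A'm := HB.pack_for {linear H -> H} A' (GRing.isLinear.Build _ _ _ _ A' linA').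
by exists Am, A'm; split => //= h; apply: injA; rewrite AA'.
Qed.

End isometry.

(** * The parallelogram law *)

Section additive_functions.
Variable R : realType.

(** As g vanishes on the integers, the bound on [0, 1] holds on the whole line,
    and then n * |g t| = |g (n t)| is bounded in n. *)
Lemma bounded_additive_eq0 (g : R -> R) (M : R) :
  (forall s t, g (s + t) = g s + g t) -> g 1 = 0 ->
  (forall t, 0 <= t <= 1 -> `|g t| <= M) -> forall t, g t = 0.
Proof.
move=> gD g1 gM t.
have g0 : g 0 = 0 by have := gD 0 0; rewrite addr0; lra.
have gn n s : g (n%:R * s) = n%:R * g s.
  by elim: n => [|n IH]; rewrite ?mul0r// -natr1 !mulrDl gD IH !mul1r.
have gN s : g (- s) = - g s.
  by have := gD s (- s); rewrite subrr g0; lra.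
have gz (z : int) : g z%:~R = 0.
  case: z => n; first by rewrite -pmulrn -[n%:R]mulr1 gn g1 mulr0.
  by rewrite NegzE mulrNz gN -pmulrn -[n.+1%:R]mulr1 gn g1 mulr0 oppr0.
have gb s : `|g s| <= M.
  rewrite -[s](subrK (Num.floor s)%:~R) gD gz addr0; apply: gM.
  have /andP[fl fu] := floor_itv s; rewrite subr_ge0 fl lerBlDr.
  by rewrite addrC ltW// -intrD1.
apply/eqP; rewrite -normr_le0; apply/negP => /negP; rewrite -ltNge => gt0.
have := gb ((Num.truncn (M / `|g t|)).+1%:R * t).
rewrite gn normrM normr_nat -ler_pdivlMr// leNgt.
by rewrite truncnS_gt.
Qed.

End additive_functions.

Section jordan_von_neumann.
Variables (R : realType) (V : lmodType R[i]) (Q : V -> R).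
Hypotheses (Q_ge0 : forall x, 0 <= Q x)
  (QZ : forall (a : R) x, Q (a%:C *: x) = a ^+ 2 * Q x)
  (Qi : forall x, Q ('i%C *: x) = Q x)
  (Qpar : forall x y, Q (x + y) + Q (x - y) = 2 * Q x + 2 * Q y).

Definition polar (x y : V) : R := (Q (x + y) - Q (x - y)) / 4.

(** Additivity of the polar form is algebra. Homogeneity over R follows from
    additivity and the bound |polar x y| <= (Q x + Q y) / 2, so that no topology
    on V is involved. *)
Lemma jordan_von_neumann : psd polar /\ forall x, polar x x = Q x.
Proof.
have Q0 : Q 0 = 0 by rewrite -(scaler0 V ((0 : R)%:C)) QZ expr0n mul0r.
have QN x : Q (- x) = Q x.
  by rewrite -scaleN1r -[-1 : R[i]](rmorphN1 (real_complex R)) QZ sqrrN expr1n mul1r.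
have pC x y : polar x y = polar y x.
  by rewrite /polar (addrC x y) -(QN (y - x)) opprB.
have p0 z : polar 0 z = 0 by rewrite /polar add0r sub0r QN subrr mul0r.
have half x y z : polar x z + polar y z = polar (x + y) (z + z) / 2.
  have h1 := Qpar (x + z) (y + z); have h2 := Qpar (x - z) (y - z).
  have e1 : x + z - (y + z) = x - y by rewrite opprD addrACA subrr addr0.
  have e2 : x - z - (y - z) = x - y by rewrite opprD addrACA subrr addr0.
  move: h1 h2; rewrite /polar e1 e2 [x + z + _]addrACA [x - z + _]addrACA -opprD.
  lra.
have pDl x y z : polar (x + y) z = polar x z + polar y z.
  by rewrite half -[LHS]addr0 -[X in _ + X](p0 z) half addr0.
have pbound x y : `|polar x y| <= (Q x + Q y) / 2.
  rewrite ler_norml /polar; have := Qpar x y.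
  by have := Q_ge0 (x + y); have := Q_ge0 (x - y); lra.
split.
  split => [//|//|a x y|x y|x].
  - pose g t := polar (t%:C *: x) y - t * polar x y.
    suff : g a = 0 by rewrite /g; lra.
    apply: (bounded_additive_eq0 (M := (Q x + Q y) / 2 + `|polar x y|)).
    + by move=> s t; rewrite /g rmorphD scalerDl pDl; ring.
    + by rewrite /g rmorph1 scale1r mul1r subrr.
    + move=> t /andP[t0 t1]; apply: le_trans (ler_normB _ _) _.
      rewrite [`|t * _|]normrM (ger0_norm t0); apply: lerD.
        apply: le_trans (pbound _ _) _; rewrite QZ.
        have : t ^+ 2 * Q x <= Q x by rewrite ler_piMl// expr_le1.
        lra.
      by have := normr_ge0 (polar x y); nra.
  - by rewrite /polar -scalerDr -scalerBr !Qi.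
  - rewrite /polar subrr Q0 subr0 divr_ge0//.
move=> x; rewrite /polar subrr Q0 subr0.
have := QZ 2 x; rewrite rmorph_nat scaler_nat mulr2n => ->.
by field.
Qed.

End jordan_von_neumann.

Section inner_product_of_form.
Variables (R : realType) (V : lmodType R[i]) (b : V -> V -> R) (B : psd b).
Hypothesis b_gt0 : forall x, x != 0 -> 0 < b x x.

(** A Hermitian form that is linear on the left has imaginary part equal to its
    real part at (x, i y). *)
Definition complex_form (x y : V) : R[i] := Complex (b x y) (b x ('i%C *: y)).

Lemma inner_product_of_form : exists ip : inner_product V,
  forall x y, ip x y = complex_form x y.
Proof.
have bi x y : b ('i%C *: x) y = - b x ('i%C *: y).
  by rewrite (psdZii B) -(psdNr B) -scaleNr; congr (b _ (_ *: _)); simpc.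
have bii x y : b x ('i%C *: ('i%C *: y)) = - b x y.
  by rewrite scalerA -expr2 sqr_i scaleN1r (psdNr B).
have fDl y x x' : complex_form (x - x') y = complex_form x y - complex_form x' y.
  by rewrite /complex_form !(psdDl B) !(psdNl B).
have fDr x y y' : complex_form x (y - y') = complex_form x y - complex_form x y'.
  by rewrite /complex_form scalerBr !(psdDr B) !(psdNr B).
have fZl y c x : complex_form (c *: x) y = c * complex_form x y.
  rewrite /complex_form (scale_complexE c) !(psdDl B) !(psdZl B) !bi bii.
  by case: c => u v /=; simpc; congr Complex; ring.
have fC x y : complex_form x y = (-1) ^+ false * Num.conj (complex_form y x).
  rewrite expr0 mul1r /complex_form /= (psdC B x).
  by congr Complex; rewrite (psdC B x) bi.
have fZr x c y : complex_form x (c *: y) = Num.conj c * complex_form x y.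
  by rewrite fC fZl rmorphM expr0 mul1r [in RHS]fC expr0 mul1r.
have fpos x : x != 0 -> 0 < complex_form x x.
  move=> x0; rewrite ltcE /= b_gt0// andbT.
  have := bi x x; rewrite (psdC B) => h; apply/eqP; lra.
pose ip := HB.pack_for {dot V for Num.conj} complex_form
  (isBilinear.Build R[i] V V R[i] *%R (Num.conj \; *%R) complex_form fDl fDr fZl fZr)
  (isHermitianSesquilinear.Build R[i] V false Num.conj complex_form fC)
  (isDotProduct.Build R[i] V complex_form fpos).
by exists ip.
Qed.

End inner_product_of_form.

(** * Integrals of time windows *)

Section weighted_integrals.
Variable R : realType.
Implicit Types (f g : R -> R) (a c k r t u : R).

Local Notation mu := (@lebesgue_measure R).

(** A class of functions that is stable under sums and products and whose members
    are integrable on every [0, c]. *)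
Definition locally_bounded f :=
  measurable_fun setT f /\
  forall c, exists M : R, forall r, 0 <= r <= c -> `|f r| <= M.

Definition integral_to c f : R := \int[mu]_(r in `[0, c]) f r.

Lemma locally_bounded_integrable c f : locally_bounded f ->
  mu.-integrable `[0, c] (EFin \o f).
Proof.
move=> [mf bf]; apply: measurable_bounded_integrable => //.
- rewrite /= lebesgue_measure_itv/=; case: ifP => // _.
  by rewrite -EFinB ltry.
- exact: measurable_funS mf.
- have [M fM] := bf c; exists M; split; first exact: num_real.
  move=> M' MM' r /=; rewrite in_itv /= => rc.
  by apply: le_trans (fM r rc) (ltW MM').
Qed.

Lemma locally_boundedD f g : locally_bounded f -> locally_bounded g ->
  locally_bounded (fun r => f r + g r).
Proof.
move=> [mf bf] [mg bg]; split; first exact: measurable_funD.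
move=> c; have [M fM] := bf c; have [M' gM] := bg c; exists (M + M') => r rc.
by apply: le_trans (ler_normD _ _) (lerD (fM r rc) (gM r rc)).
Qed.

Lemma locally_boundedM f g : locally_bounded f -> locally_bounded g ->
  locally_bounded (fun r => f r * g r).
Proof.
move=> [mf bf] [mg bg]; split; first exact: measurable_funM.
move=> c; have [M fM] := bf c; have [M' gM] := bg c; exists (M * M') => r rc.
by rewrite normrM; apply: ler_pM => //; [exact: fM | exact: gM].
Qed.

Lemma locally_bounded_cst a : locally_bounded (fun=> a).
Proof. by split => // c; exists `|a|. Qed.

Lemma locally_bounded_expR a : locally_bounded (fun r => expR (a * r)).
Proof.
split; first by apply: measurableT_comp => //; exact: measurable_funM.
move=> c; exists (expR (`|a| * c)) => r /andP[r0 rc].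
rewrite ger0_norm ?expR_ge0// ler_expR.
apply: (@le_trans _ _ (`|a| * r)); first by rewrite ler_wpM2r// ler_norm.
by rewrite ler_wpM2l.
Qed.

Definition window t r : R := \1_`[t, t + 1] r.

Lemma locally_bounded_window t : locally_bounded (window t).
Proof.
split; first exact: measurable_indic.
by move=> c; exists 1 => r _; rewrite /window indicE; case: (_ \in _); rewrite ?normr0 ?normr1.
Qed.

Lemma locally_bounded_sum I (s : seq I) (F : I -> R -> R) :
  (forall i, locally_bounded (F i)) ->
  locally_bounded (fun r => \sum_(i <- s) F i r).
Proof.
move=> bF; elim: s => [|i s IH].
  by under eq_fun do rewrite big_nil; exact: locally_bounded_cst.
by under eq_fun do rewrite big_cons; exact: locally_boundedD.
Qed.

Hint Resolve locally_boundedD locally_boundedM locally_bounded_cst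
  locally_bounded_expR locally_bounded_window : core.

Lemma integral_toD c f g : locally_bounded f -> locally_bounded g ->
  integral_to c (fun r => f r + g r) = integral_to c f + integral_to c g.
Proof. by move=> bf bg; apply: RintegralD => //; exact: locally_bounded_integrable. Qed.

Lemma integral_toZ c a f : locally_bounded f ->
  integral_to c (fun r => a * f r) = a * integral_to c f.
Proof. by move=> bf; apply: RintegralZl => //; exact: locally_bounded_integrable. Qed.

Lemma integral_to_sum c I (s : seq I) (F : I -> R -> R) :
  (forall i, locally_bounded (F i)) ->
  integral_to c (fun r => \sum_(i <- s) F i r) = \sum_(i <- s) integral_to c (F i).
Proof.
move=> bF; elim: s => [|i s IH].
  rewrite big_nil -[RHS](mul0r (integral_to c (fun=> 0))).
  rewrite -integral_toZ//; congr (integral_to _ _).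
  by apply/funext => r; rewrite big_nil mul0r.
rewrite big_cons -IH -integral_toD//; last exact: locally_bounded_sum.
by congr (integral_to _ _); apply/funext => r; rewrite big_cons.
Qed.

Lemma integral_to_ge0 c f : (forall r, 0 <= f r) -> 0 <= integral_to c f.
Proof. by move=> f0; apply: Rintegral_ge0. Qed.

Lemma integral_to_mono c c' f : locally_bounded f -> (forall r, 0 <= f r) ->
  c <= c' -> integral_to c f <= integral_to c' f.
Proof.
move=> bf f0 cc'; apply: fine_le; try exact/integrable_fin_num/locally_bounded_integrable.
apply: ge0_subset_integral => //.
- by apply/measurable_EFinP; apply: measurable_funS bf.1.
- by move=> r _; rewrite lee_fin.
- by apply: subset_itvl; rewrite bnd_simp.
Qed.

Lemma integral_expR a x y : a != 0 -> x < y ->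
  \int[mu]_(r in `[x, y]) expR (a * r) = (expR (a * y) - expR (a * x)) / a.
Proof.
move=> a0 xy.
pose F r := expR (a * r) / a.
have dF r : is_derive r 1 F (expR (a * r)).
  apply: is_derive_eq; rewrite scaler0 add0r /GRing.scale /= mulr1.
  by field.
have cF : continuous F.
  by move=> r; apply/differentiable_continuous/derivable1_diffP; have [] := dF r.
rewrite /Rintegral (@continuous_FTC2 _ _ F)//=.
- by rewrite /F -mulrBl.
- apply: continuous_subspaceT => r; apply: (@continuous_comp _ _ _ ( *%R a) expR).
    exact: mulrl_continuous.
  exact: continuous_expR.
- split => [r _||].
  + by have [] := dF r.
  + by apply: cvg_at_right_filter; exact: cF.
  + by apply: cvg_at_left_filter; exact: cF.
- by move=> r _; rewrite derive1E; have [_ ->] := dF r.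
Qed.

(** With k = 2 lambda and c = 2 this is the weight that the form alpha gives to the
    pair of times t, u; with k = 0 and c large it is the tent function. *)
Definition overlap k c t u : R :=
  integral_to c (fun r => expR (- k * r) * (window t r * window u r)).

Lemma overlapE k c t u : 0 <= t -> 0 <= u ->
  overlap k c t u =
  \int[mu]_(r in `[Num.max t u, Num.min c (Num.min t u + 1)]) expR (- k * r).
Proof.
move=> t0 u0; rewrite /overlap /integral_to.
have -> : `[Num.max t u, Num.min c (Num.min t u + 1)]%classic =
    `[0, c] `&` (`[t, t + 1] `&` `[u, u + 1]) :> set R.
  apply/seteqP; split => r /=; rewrite !in_itv /= addr_minl ge_max !le_min.
    by move=> /andP[/andP[h1 h2] /and3P[h3 h4 h5]]; rewrite h1 h2 h3 h4 h5 (le_trans t0).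
  by move=> [/andP[h0 h1] [/andP[h2 h3] /andP[h4 h5]]]; rewrite h1 h2 h3 h4 h5.
rewrite Rintegral_mkcondr; apply: eq_Rintegral => r _.
rewrite /window -[\1__ r * _]/((\1__ \* \1__) r) -indicI indicE /patch.
by case: (_ \in _); rewrite ?mulr1 ?mulr0.
Qed.

Lemma integral_empty f x y : y <= x -> \int[mu]_(r in `[x, y]) f r = 0.
Proof.
rewrite le_eqVlt => /predU1P[->|yx]; first by rewrite set_itv1 Rintegral_set1.
by rewrite set_itv_ge ?Rintegral_set0// bnd_simp -ltNge.
Qed.

(** A delay by s scales the exponential weight, and the fixed end point c of the
    integration moves to c - s relative to the windows. *)
Lemma overlap_shift k c s t u : k != 0 -> 0 <= s -> 0 <= t -> 0 <= u ->
  overlap k c (t + s) (u + s) = expR (- k * s) * overlap k (c - s) t u.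
Proof.
move=> k0 s0 t0 u0; rewrite !overlapE ?addr_ge0//.
have -> : Num.max (t + s) (u + s) = Num.max t u + s.
  by rewrite addr_maxl.
have -> : Num.min c (Num.min (t + s) (u + s) + 1) = Num.min (c - s) (Num.min t u + 1) + s.
  by rewrite -addr_minl [RHS]addr_minl subrK addrAC.
move: (Num.max t u) (Num.min _ _) => a b.
have [ab|ba] := ltP a b; last by rewrite !integral_empty ?mulr0// lerD2r.
rewrite !integral_expR ?oppr_eq0 ?ltrD2r//.
by rewrite !mulrDr !expRD; field.
Qed.

Lemma overlap_tent c t u : 0 <= t -> 0 <= u -> t + 1 <= c -> u + 1 <= c ->
  overlap 0 c t u = tent t u.
Proof.
move=> t0 u0 tc uc; rewrite overlapE//.
under eq_Rintegral do rewrite oppr0 mul0r expR0.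
rewrite Rintegral_cst// mul1r /= lebesgue_measure_itv /= lte_fin /tent.
have -> : Num.min c (Num.min t u + 1) = Num.min t u + 1.
  by apply/min_idPr; case: (leP t u).
have -> : 1 - `|t - u| = Num.min t u + 1 - Num.max t u.
  by case: (leP t u) => tu; [rewrite ler0_norm | rewrite gtr0_norm]; lra.
case: ltP => h /=; apply/esym.
  by apply/max_idPl; rewrite subr_ge0 ltW.
by apply/max_idPr; rewrite subr_le0.
Qed.

Lemma integral_window c t : 0 <= t -> t + 1 <= c -> integral_to c (window t) = 1.
Proof.
move=> t0 tc; have := overlap_tent t0 t0 tc tc.
rewrite /tent subrr normr0 subr0 max_l// => <-; rewrite /overlap.
congr (integral_to _ _); apply/funext => r.
rewrite oppr0 mul0r expR0 mul1r /window indicE.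
by case: (_ \in _); rewrite ?mulr1 ?mulr0.
Qed.

Section positive_kernels.
Variables (s : seq R) (K : R -> R -> R).
Hypothesis K_ge0 : forall g : R -> R,
  0 <= \sum_(t <- s) \sum_(u <- s) g t * g u * K t u.

Lemma integral_kernel c k (F : R -> R -> R) : (forall t, locally_bounded (F t)) ->
  integral_to c (fun r => expR (- k * r) *
      \sum_(t <- s) \sum_(u <- s) F t r * F u r * K t u) =
  \sum_(t <- s) \sum_(u <- s)
    integral_to c (fun r => expR (- k * r) * (F t r * F u r)) * K t u.
Proof.
move=> bF.
have e r : expR (- k * r) * (\sum_(t <- s) \sum_(u <- s) F t r * F u r * K t u) =
    \sum_(t <- s) \sum_(u <- s) K t u * (expR (- k * r) * (F t r * F u r)).
  rewrite big_distrr; apply: eq_bigr => t _.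
  by rewrite big_distrr; apply: eq_bigr => u _ /=; ring.
rewrite (funext e).
rewrite integral_to_sum; last by move=> t; apply: locally_bounded_sum => u; auto.
apply: eq_bigr => t _; rewrite integral_to_sum; last by auto.
by apply: eq_bigr => u _; rewrite integral_toZ 1?mulrC; auto.
Qed.

Lemma overlap_kernel c k :
  \sum_(t <- s) \sum_(u <- s) overlap k c t u * K t u =
  integral_to c (fun r => expR (- k * r) *
    \sum_(t <- s) \sum_(u <- s) window t r * window u r * K t u).
Proof. by rewrite integral_kernel. Qed.

Lemma locally_bounded_kernel k : locally_bounded (fun r => expR (- k * r) *
    \sum_(t <- s) \sum_(u <- s) window t r * window u r * K t u).
Proof.
apply: locally_boundedM => //; apply: locally_bounded_sum => t.
by apply: locally_bounded_sum => u; auto.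
Qed.

Lemma overlap_kernel_ge0 c k :
  0 <= \sum_(t <- s) \sum_(u <- s) overlap k c t u * K t u.
Proof.
rewrite overlap_kernel; apply: integral_to_ge0 => r.
by rewrite mulr_ge0 ?expR_ge0//; exact: (K_ge0 (window^~ r)).
Qed.

Lemma overlap_kernel_mono c c' k : c <= c' ->
  \sum_(t <- s) \sum_(u <- s) overlap k c t u * K t u <=
  \sum_(t <- s) \sum_(u <- s) overlap k c' t u * K t u.
Proof.
move=> cc'; rewrite !overlap_kernel; apply: integral_to_mono => // [|r].
  exact: locally_bounded_kernel.
by rewrite mulr_ge0 ?expR_ge0//; exact: (K_ge0 (window^~ r)).
Qed.

(** Cauchy-Schwarz for the integral of a vector-valued function: if the kernel K is
    the Gram matrix of vectors x_t, the sum on the left is the squared norm of the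
    integral of sum_t window t r x_t. It is obtained by integrating the nonnegative
    function exp (- k r) sum_(t, u) F t r F u r K t u, where F t differs from
    window t by the multiple of exp (k r) that makes its integral vanish. *)
Lemma overlap_jensen c k : 0 < integral_to c (fun r => expR (k * r)) ->
  \sum_(t <- s) \sum_(u <- s)
    integral_to c (window t) * integral_to c (window u) * K t u <=
  integral_to c (fun r => expR (k * r)) *
    \sum_(t <- s) \sum_(u <- s) overlap k c t u * K t u.
Proof.
set A := integral_to c _ => A0.
pose X t := integral_to c (window t); pose v t := X t / A.
pose F t r := window t r + (- v t) * expR (k * r).
have bF t : locally_bounded (F t) by rewrite /F; auto 6.
have : 0 <= integral_to c (fun r => expR (- k * r) *
    \sum_(t <- s) \sum_(u <- s) F t r * F u r * K t u).
  apply: integral_to_ge0 => r; by rewrite mulr_ge0 ?expR_ge0//; exact: (K_ge0 (F^~ r)).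
rewrite (integral_kernel c k bF).
have FE t u : integral_to c (fun r => expR (- k * r) * (F t r * F u r)) =
    overlap k c t u - X t * X u / A.
  rewrite (_ : (fun r => _) = fun r => expR (- k * r) * (window t r * window u r) +
     ((- v u) * window t r + ((- v t) * window u r + (v t * v u) * expR (k * r)))).
    rewrite !integral_toD ?integral_toZ; auto.
    by rewrite -/(overlap k c t u) -/(X t) -/(X u) -/A /v; field; rewrite gt_eqF.
  apply/funext => r; rewrite /F.
  have -> : expR (k * r) = (expR (- k * r))^-1 by rewrite mulNr expRN invrK.
  by field; rewrite gt_eqF// expR_gt0.
under eq_bigr do under eq_bigr do rewrite FE mulrBl.
under eq_bigr do rewrite sumrB.
rewrite sumrB subr_ge0 => h.
rewrite -(ler_pM2l A0) in h; apply: le_trans h.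
rewrite big_distrr le_eqVlt; apply/orP; left; apply/eqP; apply: eq_bigr => t _.
rewrite big_distrr; apply: eq_bigr => u _ /=.
by rewrite -/(X t) -/(X u); field; rewrite gt_eqF.
Qed.

End positive_kernels.

End weighted_integrals.

(** * Invariant means on the circle *)

Section circle.
Variable R : realType.
Implicit Types (x : circle R) (y s : R).

Definition circle_pi s : circle R := \pi%qT s.

(** Representatives in R of points of the circle are additive up to an integer. *)
Lemma repr_shift x s :
  exists k : int, repr (x + circle_pi s) = repr x + s + k%:~R.
Proof.
pose I : zmodClosed R := [the zmodClosed R of (@Num.int_num_subdef R : {pred R})].
have : repr (x + circle_pi s) - (repr x + s) \in I.
  rewrite (Quotient.idealrBE I) reprK.
  by rewrite (Quotient.pi_add I) reprK.
move=> /intrP[k kE]; exists k; rewrite -kE; ring.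
Qed.

Lemma fracpart_itv y : 0 <= fracpart y < 1.
Proof.
have /andP[fl fu] := floor_itv y.
by rewrite /fracpart subr_ge0 fl ltrBlDl -intrD1.
Qed.

Lemma floorDint y (k : int) : Num.floor (y + k%:~R) = (Num.floor y + k)%R.
Proof. by rewrite floorDrz ?intr_int// intrKfloor. Qed.

Lemma fracpart_shift x s : fracpart (repr (x + circle_pi s)) = fracpart (repr x + s).
Proof.
have [k ->] := repr_shift x s.
by rewrite /fracpart floorDint intrD; ring.
Qed.

(** The floor increases by one between y - d and y exactly when y has gone past an
    integer by less than d. *)
Lemma fracpart_lt_floor y (d : R) : 0 < d <= 1 ->
  ((fracpart y < d)%R : nat)%:R = (Num.floor y - Num.floor (y - d))%:~R :> R.
Proof.
move=> /andP[d0 d1]; have /andP[f0 f1] := fracpart_itv y.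
have {f0 f1} : Num.floor (y - d) = Num.floor y - ((fracpart y < d)%R : nat)%:R.
  apply/floor_def; rewrite !intrD !intrN.
  rewrite -[in X in X <= _ < _](subrK (fracpart y) (Num.floor y)%:~R).
  have -> : (Num.floor y)%:~R = y - fracpart y by rewrite /fracpart; ring.
  by case: (ltP (fracpart y) d) => h; rewrite ?mulr1z ?mulr0z; apply/andP; split; lra.
move=> ->; rewrite opprB addrCA subrr addr0.
by case: (_ < _).
Qed.

End circle.

Section mean.
Variables (R : realType) (m : (circle R -> R[i]) -> R[i]) (meanm : invariant_mean m).
Implicit Types (f g : circle R -> R).

(** Positivity makes m real on bounded real functions, so that nothing is lost by
    taking the real part. *)
Definition rmean f : R := complex.Re (m (fun x => (f x)%:C)).

Definition bounded_function f := exists M : R, forall x, `|f x| <= M.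

Let bndC f : bounded_function f -> exists M : R[i], forall x, `|(f x)%:C| <= M.
Proof.
move=> [M fM]; exists M%:C => x.
by rewrite normc_def /= expr0n addr0 sqrtr_sqr lecR.
Qed.

Lemma rmean_linear (a : R) f g : bounded_function f -> bounded_function g ->
  rmean (fun x => a * f x + g x) = a * rmean f + rmean g.
Proof.
move=> /bndC bf /bndC bg; case: meanm => lin _ _ _ _.
rewrite /rmean -complex_ReZ -complex_ReD -lin//; congr (complex.Re (m _)).
by apply/funext => x; rewrite rmorphD rmorphM.
Qed.

Lemma rmean_cst (a : R) : rmean (fun=> a) = a.
Proof.
have b1 : bounded_function (fun=> 1) by exists 1 => x; rewrite normr1.
have b0 : bounded_function (fun=> 0) by exists 0 => x; rewrite normr0.
have r1 : rmean (fun=> 1) = 1 by rewrite /rmean; case: meanm => _ _ -> _ _.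
have r0 : rmean (fun=> 0) = 0.
  have := rmean_linear 1 b0 b0; rewrite (_ : (fun _ => _) = (fun=> 0)); first by lra.
  by apply/funext => x; rewrite mulr0 addr0.
have := rmean_linear a b1 b0; by rewrite r1 r0 /= mulr1 addr0 => ->.
Qed.

Lemma bounded_function_linear (a : R) f g : bounded_function f -> bounded_function g ->
  bounded_function (fun x => a * f x + g x).
Proof.
move=> [M fM] [M' gM]; exists (`|a| * M + M') => x.
apply: le_trans (ler_normD _ _) (lerD _ (gM x)).
by rewrite normrM ler_wpM2l.
Qed.

Lemma bounded_function_cst (a : R) : bounded_function (fun=> a).
Proof. by exists `|a|. Qed.

Lemma rmeanZ (a : R) f : bounded_function f -> rmean (fun x => a * f x) = a * rmean f.
Proof.
move=> bf; have := rmean_linear a bf (bounded_function_cst 0); rewrite rmean_cst addr0 => <-.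
by congr rmean; apply/funext => x; rewrite addr0.
Qed.

Lemma rmean_ge0 f : bounded_function f -> (forall x, 0 <= f x) -> 0 <= rmean f.
Proof.
move=> /bndC bf f0; case: meanm => _ pos _ _ _.
have := pos _ bf; rewrite lecE => /(_ _)/andP[] // x.
by rewrite ler0c.
Qed.

Lemma ler_rmean f g : bounded_function f -> bounded_function g ->
  (forall x, f x <= g x) -> rmean f <= rmean g.
Proof.
move=> bf bg fg; have := rmean_ge0 (bounded_function_linear (-1) bf bg).
rewrite rmean_linear//= mulN1r addrC subr_ge0; apply => x.
by rewrite mulN1r addrC subr_ge0.
Qed.

Lemma rmean_shift f s : bounded_function f -> rmean (fun x => f (x + s)) = rmean f.
Proof.
move=> /bndC bf; case: meanm => _ _ _ shift _.
by rewrite /rmean -(shift _ s bf).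
Qed.

Lemma rmean_sum_shift f (d : R) n : bounded_function f ->
  rmean (fun x => \sum_(i < n) f (x + circle_pi (i%:R * d))) = n%:R * rmean f.
Proof.
move=> bf; have bs s : bounded_function (fun x => f (x + s)).
  by case: bf => M fM; exists M => x.
suff [] : bounded_function (fun x => \sum_(i < n) f (x + circle_pi (i%:R * d))) /\
   rmean (fun x => \sum_(i < n) f (x + circle_pi (i%:R * d))) = n%:R * rmean f by [].
elim: n => [|n [IH1 IH2]].
  under eq_fun do rewrite big_ord0; rewrite rmean_cst mul0r; split => //.
  exact: bounded_function_cst.
have -> : (fun x => \sum_(i < n.+1) f (x + circle_pi (i%:R * d))) = fun x =>
   1 * f (x + circle_pi (n%:R * d)) + \sum_(i < n) f (x + circle_pi (i%:R * d)).
  by apply/funext => x; rewrite big_ord_recr /= mul1r addrC.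
split; first exact: bounded_function_linear.
by rewrite rmean_linear// IH2 rmean_shift// -natr1; ring.
Qed.

(** By fracpart_lt_floor the sum of n rotated copies of the indicator of the arc,
    by successive multiples of d, telescopes to a difference of floors of two
    numbers at distance n d. It is thus at least n d - 1, and its mean is n times
    the mean of the arc. *)
Lemma rmean_arc (d : R) : 0 < d <= 1 ->
  d <= rmean (fun x => ((fracpart (repr x) < d)%R : nat)%:R).
Proof.
move=> d01; set f := fun x => _.
have bf : bounded_function f by exists 1 => x; rewrite /f; case: (_ < _); rewrite ?normr1 ?normr0.
have key n : n%:R * d - 1 <= n%:R * rmean f.
  rewrite -(rmean_sum_shift d n bf) -[leLHS]rmean_cst.
  have bs : bounded_function (fun x => \sum_(i < n) f (x + circle_pi (i%:R * d))).
    exists n%:R => x; apply: le_trans (ler_norm_sum _ _ _) _.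
    rewrite (_ : n%:R = \sum_(i < n) 1); last by rewrite sumr_const card_ord.
    apply: ler_sum => i _.
    by rewrite /f; case: (_ < _); rewrite ?normr1 ?normr0.
  apply: ler_rmean => [||x]; [exact: bounded_function_cst|exact: bs|].
  have -> : \sum_(i < n) f (x + circle_pi (i%:R * d)) =
      (Num.floor (repr x + n%:R * d - d) - Num.floor (repr x - d))%:~R.
    elim: n {bs} => [|n IH]; first by rewrite big_ord0 mul0r addr0 subrr.
    rewrite big_ord_recr /= IH /f fracpart_shift fracpart_lt_floor//.
    rewrite -intrD [_ - _ + (_ - _)]addrC subrKA -natr1.
    by congr ((Num.floor _ - _)%:~R); ring.
  have /andP[_] := floor_itv (repr x + n%:R * d - d).
  have /andP[+ _] := floor_itv (repr x - d).
  rewrite !intrD intrN; lra.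
apply/ler_addgt0Pl => e e0.
pose n := (Num.truncn e^-1).+1.
have ne : 1 < n%:R * e by rewrite -ltr_pdivrMr// div1r truncnS_gt.
have n0 : 0 < n%:R :> R by rewrite ltr0n.
by rewrite -(ler_pM2l n0) mulrDr; have := key n; lra.
Qed.

End mean.

(** * Semigroups bounded on compact intervals *)

Section equivalent_norm_operators.
Variables (R : realType) (H : hilbertType R) (ip : inner_product H) (C : R).
Hypothesis normC : forall h, rnorm h <= ipnorm ip h <= C * rnorm h.

Lemma equivalent_opnorm_bound (A : {linear H -> H}) (a : R) : 0 <= C ->
  continuous A -> opnorm (ipnorm ip) A <= a ->
  forall h, ipnorm ip (A h) <= a * ipnorm ip h.
Proof.
move=> C0 /continuous_boundedP[K K0 AK] Aa h.
have [_ bA] := opnorm_bound (rip_psd ip) (mulr_ge0 C0 K0) (A := A) (ltac:(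
  move=> k; have /andP[_ h1] := normC (A k); apply: le_trans h1 _;
  rewrite -mulrA ler_wpM2l//; apply: le_trans (AK k) _; rewrite ler_wpM2l//;
  by have /andP[] := normC k)).
apply: le_trans (bA h) _; rewrite ler_wpM2r// ?snorm_ge0//.
Qed.

End equivalent_norm_operators.

Section locally_bounded_semigroup.
Variables (R : realType) (H : hilbertType R) (T : R -> {linear H -> H}).
Variables (ip1 ip2 : inner_product H) (C1 C2 lambda tau : R).
Hypotheses (semigroupT : semigroup T) (C1_ge1 : 1 <= C1) (C2_ge1 : 1 <= C2)
  (lambda_gt0 : 0 < lambda) (tau_gt0 : 0 < tau)
  (norm1 : forall h, rnorm h <= ipnorm ip1 h <= C1 * rnorm h)
  (norm2 : forall h, rnorm h <= ipnorm ip2 h <= C2 * rnorm h)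
  (growth1 : forall t : R, 0 <= t -> opnorm (ipnorm ip1) (T t) <= expR (lambda * t))
  (contr2 : opnorm (ipnorm ip2) (T tau) <= 1).

Let T0E h : T 0 h = h. Proof. by case: semigroupT. Qed.
Let TD s t h : 0 <= s -> 0 <= t -> T (s + t) h = T s (T t h).
Proof. by move=> s0 t0; case: semigroupT => _ _ ->. Qed.
Let C1_ge0 : 0 <= C1. Proof. exact: le_trans C1_ge1. Qed.
Let C2_ge0 : 0 <= C2. Proof. exact: le_trans C2_ge1. Qed.

Lemma ipnorm1_growth (t : R) h : 0 <= t ->
  ipnorm ip1 (T t h) <= expR (lambda * t) * ipnorm ip1 h.
Proof.
move=> t0; apply: (equivalent_opnorm_bound norm1 C1_ge0 _ (growth1 t0)).
by case: semigroupT => cT _ _; exact: cT.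
Qed.

Lemma rnorm_growth (t : R) h : 0 <= t ->
  rnorm (T t h) <= C1 * expR (lambda * t) * rnorm h.
Proof.
move=> t0; have /andP[h1 _] := norm1 (T t h); apply: le_trans h1 _.
apply: le_trans (ipnorm1_growth h t0) _; rewrite [C1 * _]mulrC -mulrA.
by rewrite ler_wpM2l ?expR_ge0//; have /andP[] := norm1 h.
Qed.

Let opnorm_facts (t : R) : 0 <= t -> 0 <= opnorm (@rnorm R H) (T t) /\
  forall h, rnorm (T t h) <= opnorm (@rnorm R H) (T t) * rnorm h.
Proof.
move=> t0; have B := rip_psd (@inner R H).
have -> : @rnorm R H = snorm (rip (@inner R H)) by apply/funext => h; rewrite rnormE.
apply: (opnorm_bound B (C := C1 * expR (lambda * t))).
  by rewrite mulr_ge0 ?expR_ge0.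
by move=> h; rewrite -!rnormE rnorm_growth.
Qed.

Let opnorm_growth (t : R) : 0 <= t -> opnorm (@rnorm R H) (T t) <= C1 * expR (lambda * t).
Proof.
move=> t0; apply: rnorm_opnorm_le; first by rewrite mulr_ge0 ?expR_ge0.
by move=> h; exact: rnorm_growth.
Qed.

Definition sup_sqr_opnorm (D : set R) : R :=
  sup [set opnorm (@rnorm R H) (T s) ^+ 2 | s in D].

Lemma sup_sqr_opnormP (D : set R) (c : R) :
  (forall s, D s -> 0 <= s <= c) -> D 0 ->
  0 <= sup_sqr_opnorm D /\
  forall s h, D s -> rnorm (T s h) ^+ 2 <= sup_sqr_opnorm D * rnorm h ^+ 2.
Proof.
move=> Dc D0.
have ub s : D s -> opnorm (@rnorm R H) (T s) ^+ 2 <= sup_sqr_opnorm D.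
  move=> Ds; apply: ub_le_sup; last by exists s.
  exists ((C1 * expR (lambda * c)) ^+ 2) => _ [r Dr <-].
  have /andP[r0 rc] := Dc _ Dr; have [op0 _] := opnorm_facts r0.
  rewrite ler_pXn2r ?nnegrE ?mulr_ge0 ?expR_ge0//.
  apply: le_trans (opnorm_growth r0) _.
  by rewrite ler_wpM2l// ler_expR ler_wpM2l// ltW.
split; first by apply: le_trans (ub 0 D0); rewrite sqr_ge0.
move=> s h Ds; have /andP[s0 _] := Dc _ Ds; have [op0 opT] := opnorm_facts s0.
apply: (@le_trans _ _ (opnorm (@rnorm R H) (T s) ^+ 2 * rnorm h ^+ 2)).
  by rewrite -exprMn ler_pXn2r ?nnegrE ?mulr_ge0 ?rnorm_ge0.
by rewrite ler_wpM2r ?sqr_ge0// ub.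
Qed.

Lemma sup_sqr_opnorm_coP (c : R) : 0 < c ->
  0 <= sup_sqr_opnorm (`[0, c[) /\
  forall s h, 0 <= s < c -> rnorm (T s h) ^+ 2 <= sup_sqr_opnorm (`[0, c[) * rnorm h ^+ 2.
Proof.
move=> c0; have [||S0 SP] := @sup_sqr_opnormP `[0, c[ c.
- by move=> s /=; rewrite in_itv /= => /andP[-> /ltW].
- by rewrite /= in_itv /= lexx.
- by split=> // s h sc; apply: SP; rewrite /= in_itv.
Qed.

Lemma sup_sqr_opnorm_ccP (c : R) : 0 <= c ->
  0 <= sup_sqr_opnorm (`[0, c]) /\
  forall s h, 0 <= s <= c -> rnorm (T s h) ^+ 2 <= sup_sqr_opnorm (`[0, c]) * rnorm h ^+ 2.
Proof.
move=> c0; have [||S0 SP] := @sup_sqr_opnormP `[0, c] c.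
- by move=> s /=; rewrite in_itv.
- by rewrite /= in_itv /= lexx.
- by split=> // s h sc; apply: SP; rewrite /= in_itv.
Qed.

Lemma ipnorm2_contraction n (t : R) h : 0 <= t ->
  ipnorm ip2 (T (t + tau * n%:R) h) <= ipnorm ip2 (T t h).
Proof.
move=> t0; elim: n => [|n IH]; first by rewrite mulr0 addr0.
apply: le_trans _ IH.
have -> : t + tau * n.+1%:R = tau + (t + tau * n%:R) by rewrite -natr1; ring.
have tn : 0 <= t + tau * n%:R by rewrite addr_ge0// mulr_ge0// ltW.
rewrite [T (tau + _) h]TD ?(ltW tau_gt0)//.
have ctau : continuous (T tau).
  by case: semigroupT => cT _ _; apply: cT; exact: ltW.
have := equivalent_opnorm_bound norm2 C2_ge0 ctau contr2 (T (t + tau * n%:R) h).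
by rewrite mul1r.
Qed.

Section averaged_form.
Variables (m : (circle R -> R[i]) -> R[i]) (meanm : invariant_mean m).

Let time (x : circle R) : R := tau * fracpart (repr x).

Let time_itv x : 0 <= time x < tau.
Proof.
have /andP[f0 f1] := fracpart_itv (repr x).
by rewrite /time mulr_ge0 ?(ltW tau_gt0)//= -[ltRHS]mulr1 ltr_pM2l.
Qed.

Let sqr2 h x : R := rip ip2 (T (time x) h) (T (time x) h).

Let sqr2E h x : sqr2 h x = ipnorm ip2 (T (time x) h) ^+ 2.
Proof. by rewrite sqr_ipnorm. Qed.

Let mean_formE h : complex.Re (mean_form m tau ip2 T h h) = rmean m (sqr2 h).
Proof.
congr (complex.Re (m _)); apply/funext => x; rewrite /transport /sqr2 /rip.
have := ip_conj ip2 (T (time x) h) (T (time x) h); rewrite /time.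
by case: (ip2 _ _) => u v [] vN; congr Complex; lra.
Qed.

Let bounded_sqr2 h : bounded_function (sqr2 h).
Proof.
exists ((C2 * (C1 * expR (lambda * tau) * rnorm h)) ^+ 2) => x.
rewrite sqr2E ger0_norm ?sqr_ge0//.
have h0 := rnorm_ge0 h; have /andP[t0 t1] := time_itv x.
rewrite ler_pXn2r ?nnegrE ?sqrtr_ge0 ?mulr_ge0 ?expR_ge0//.
have /andP[_ h2] := norm2 (T (time x) h); apply: le_trans h2 _.
rewrite ler_wpM2l//; apply: le_trans (rnorm_growth h t0) _.
by rewrite ler_wpM2r// ler_wpM2l// ler_expR ler_wpM2l ?ltW.
Qed.

Local Notation mean_sqr h := (complex.Re (mean_form m tau ip2 T h h)).

(** Delaying time by s rotates the circle by s / tau, except that the times that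
    wrap around are followed by powers of the contraction T tau. *)
Lemma mean_form_contraction (s : R) h : 0 <= s -> mean_sqr (T s h) <= mean_sqr h.
Proof.
move=> s0; rewrite !mean_formE.
rewrite -[leRHS](rmean_shift meanm (circle_pi (s / tau)))//.
apply: ler_rmean => // [|x].
  by case: (bounded_sqr2 h) => M hM; exists M => x; exact: hM.
rewrite !sqr2E; have /andP[t0 _] := time_itv x.
have /andP[t'0 _] := time_itv (x + circle_pi (s / tau)).
rewrite ler_pXn2r ?nnegrE ?sqrtr_ge0// -TD//.
have [n nE] : exists n : nat,
    Num.floor (repr x + s / tau) = (Num.floor (repr x) + n%:Z)%R.
  have : Num.floor (repr x) <= Num.floor (repr x + s / tau).
    by apply: le_floor; rewrite lerDl divr_ge0// ltW.
  rewrite -subr_ge0; case E : (_ - _) => [n|//] _; exists n.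
  by rewrite -E addrCA subrr addr0.
have -> : time x + s = time (x + circle_pi (s / tau)) + tau * n%:R.
  rewrite /time fracpart_shift /fracpart nE intrD -pmulrn.
  by field; rewrite gt_eqF.
exact: ipnorm2_contraction.
Qed.

Lemma mean_form_le h :
  mean_sqr h <= C2 ^+ 2 * sup_sqr_opnorm `[0, tau[ * rnorm h ^+ 2.
Proof.
have [S0 SP] := sup_sqr_opnorm_coP tau_gt0.
rewrite mean_formE -[leRHS](rmean_cst meanm).
apply: ler_rmean => // [|x]; first exact: bounded_function_cst.
rewrite sqr2E; have h1 := SP (time x) h (time_itv x).
apply: (@le_trans _ _ (C2 ^+ 2 * rnorm (T (time x) h) ^+ 2)).
  rewrite -exprMn ler_pXn2r ?nnegrE ?sqrtr_ge0 ?mulr_ge0 ?rnorm_ge0//.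
  by have /andP[] := norm2 (T (time x) h).
by rewrite -mulrA ler_wpM2l ?sqr_ge0.
Qed.

(** T 1 = T (1 - t) T t for each t in [0, 1], and these times fill at least the
    fraction 1 / max 1 tau of the period by rmean_arc. *)
Lemma rnorm_T1_le_mean_form h : rnorm (T 1 h) ^+ 2 <=
  Num.max 1 tau * sup_sqr_opnorm `[0, 1] * mean_sqr h.
Proof.
have [S0 SP] := sup_sqr_opnorm_ccP ler01.
set S := sup_sqr_opnorm _ in S0 SP *.
pose d : R := (Num.max 1 tau)^-1.
have m0 : 0 < Num.max 1 tau by rewrite lt_max ltr01.
have d01 : 0 < d <= 1.
  by rewrite invr_gt0 m0/= invf_le1// le_max lexx.
pose f (x : circle R) : R := ((fracpart (repr x) < d)%R : nat)%:R.
have bf : bounded_function f.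
  by exists 1 => x; rewrite /f; case: (_ < _); rewrite ?normr1 ?normr0.
have pointwise x : rnorm (T 1 h) ^+ 2 * f x <= S * sqr2 h x.
  rewrite /f; case: ltP => [fd|_]; last by rewrite mulr0 mulr_ge0// sqr2E sqr_ge0.
  have /andP[t0 _] := time_itv x.
  have t1 : time x <= 1.
    rewrite /time mulrC -ler_pdivlMr// div1r; apply: le_trans (ltW fd) _.
    by rewrite lef_pV2 ?posrE// le_max lexx orbT.
  rewrite mulr1 -[1](subrK (time x)) TD ?subr_ge0//.
  have := SP (1 - time x) (T (time x) h); rewrite subr_ge0 t1 gerBl t0.
  move=> /(_ isT) h1; apply: le_trans h1 _; rewrite ler_wpM2l// sqr2E.
  rewrite ler_pXn2r ?nnegrE ?sqrtr_ge0 ?rnorm_ge0//.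
  by have /andP[] := norm2 (T (time x) h).
have : rmean m (fun x => rnorm (T 1 h) ^+ 2 * f x) <= rmean m (fun x => S * sqr2 h x).
  have bZ a g : bounded_function g -> bounded_function (fun x => a * g x).
    move=> bg; have := bounded_function_linear a bg (bounded_function_cst 0).
    by move=> [M gM]; exists M => x; have := gM x; rewrite addr0.
  by apply: (ler_rmean meanm); [exact: bZ|exact: bZ|].
rewrite !(rmeanZ meanm)// -mean_formE => h1.
have := ler_wpM2l (sqr_ge0 (rnorm (T 1 h))) (rmean_arc meanm d01).
move=> /le_trans/(_ h1); rewrite /d ler_pdivrMr// => h2.
by apply: le_trans h2 _; rewrite mulrC mulrA.
Qed.

End averaged_form.
End locally_bounded_semigroup.

(** * Positive definiteness of the two-sided extension of a contraction semigroup *)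

Section dilation_kernel.
Variables (R : realType) (V : lmodType R[i]) (b : V -> V -> R) (B : psd b).
Variable T : R -> {linear V -> V}.
Hypotheses (T0E : forall h, T 0 h = h)
  (TD : forall s t h, 0 <= s -> 0 <= t -> T (s + t) h = T s (T t h))
  (Tcontr : forall s h, 0 <= s -> b (T s h) (T s h) <= b h h).
Implicit Types (t u a : R) (s : seq R) (x y : V) (f : R -> V).

(** The form < Phi (t - u) x, y >, where Phi extends a contraction semigroup to
    negative times by adjoints, written without the adjoints. *)
Definition dilation_kernel t u x y : R :=
  if u <= t then b (T (t - u) x) y else b x (T (u - t) y).

Lemma dilation_kernelC t u x y : dilation_kernel t u x y = dilation_kernel u t y x.
Proof.
rewrite /dilation_kernel; case: ltgtP => [||->]; rewrite ?subrr ?T0E.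
all: by rewrite (psdC B).
Qed.

Lemma dilation_kernelZ t u (c d : R) x y :
  dilation_kernel t u (c%:C *: x) (d%:C *: y) = c * d * dilation_kernel t u x y.
Proof.
rewrite /dilation_kernel; case: ifP => _.
  by rewrite linearZ /= (psdZl B) (psdZr B) mulrA.
by rewrite linearZ /= (psdZl B) (psdZr B) mulrA.
Qed.

(** Positive definiteness of Phi in the quantitative form which otherwise comes
    from the unitary dilation: z is the compression to time a of the vector with
    squared norm equal to the right-hand side. Split off the earliest time t: with
    z' the sum of the later vectors pulled back to time t, the right-hand side is
    b x_t x_t + 2 b z' x_t plus the sum over the later times, which is at least
    b z' z' by induction. Hence it is at least b (x_t + z') (x_t + z'), and the
    contraction T (t - a) maps x_t + z' to z. *)
Lemma dilation_kernel_ge s a f : sorted <=%R s -> all (>= a) s ->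
  let z := \sum_(t <- s) T (t - a) (f t) in
  b z z <= \sum_(t <- s) \sum_(u <- s) dilation_kernel t u (f t) (f u).
Proof.
elim: s a => [|t s IH] a /=; first by rewrite !big_nil (psd0l B).
move=> st /andP[at_ as_].
have ts : all (>= t) s by apply: order_path_min st; exact: le_trans.
have {}IH := IH t (path_sorted st) ts.
set z := \sum_(u <- s) T (u - t) (f u) in IH.
have ktu u : u \in s -> dilation_kernel u t (f u) (f t) = b (T (u - t) (f u)) (f t).
  by move=> us; rewrite /dilation_kernel (allP ts).
have row : \sum_(u <- s) dilation_kernel u t (f u) (f t) = b z (f t).
  by rewrite (psd_suml B); apply: eq_big_seq => u; exact: ktu.
have -> : \sum_(u <- t :: s) T (u - a) (f u) = T (t - a) (f t + z).
  rewrite big_cons linearD /= linear_sum; congr (_ + _).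
  apply: eq_big_seq => u us /=; rewrite -TD ?subr_ge0 ?(allP ts)//.
  by congr (T _ _); ring.
apply: le_trans (Tcontr _ _) _; first by rewrite subr_ge0.
rewrite big_cons; under [X in _ <= _ + X]eq_bigr do rewrite big_cons.
rewrite big_cons big_split /= row.
under eq_bigr do rewrite dilation_kernelC.
rewrite row (psdDl B) !(psdDr B) (psdC B (f t) z).
rewrite {1}/dilation_kernel lexx subrr T0E; have := IH; rewrite /=; lra.
Qed.

Lemma dilation_kernel_ge0 s f : sorted <=%R s -> all (>= 0) s ->
  forall g : R -> R, 0 <= \sum_(t <- s) \sum_(u <- s)
    g t * g u * dilation_kernel t u (f t) (f u).
Proof.
move=> ss s0 g; have := dilation_kernel_ge (fun t => (g t)%:C *: f t) ss s0.
move=> /(le_trans (psd_ge0 B _)).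
by under eq_bigr do under eq_bigr do rewrite dilation_kernelZ.
Qed.

(** Weights that vanish before time a leave only the times to which
    dilation_kernel_ge applies. *)
Lemma dilation_kernel_later_ge a s (g : R -> R) f : sorted <=%R s ->
  (forall t, t \in s -> t < a -> g t = 0) ->
  let z := \sum_(t <- s | a <= t) T (t - a) ((g t)%:C *: f t) in
  b z z <= \sum_(t <- s) \sum_(u <- s) g t * g u * dilation_kernel t u (f t) (f u).
Proof.
move=> ss g0 /=; set z := \sum_(t <- s | _) _.
have fa : all (>= a) [seq t <- s | a <= t] by apply/allP => t; rewrite mem_filter => /andP[].
have := dilation_kernel_ge (fun t => (g t)%:C *: f t) (sorted_filter le_trans _ ss) fa.
rewrite /= big_filter -/z => /le_trans; apply; rewrite big_filter.
under eq_bigr do rewrite big_filter.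
rewrite le_eqVlt; apply/orP; left; apply/eqP.
rewrite big_mkcond; apply: eq_big_seq => t ts; case: ltP => ta.
  by rewrite big1// => u _; rewrite (g0 t)// !mul0r.
rewrite big_mkcond; apply: eq_big_seq => u us; case: ltP => ua.
  by rewrite (g0 u)// mulr0 mul0r.
by rewrite dilation_kernelZ.
Qed.

End dilation_kernel.

(** * The form q *)

Lemma fsbig_supp_seq (R : realType) (H : hilbertType R) (W : nmodType)
    (f : R -> H) (F : R -> W) (s : seq R) : uniq s -> supp f `<=` [set` s] ->
  (forall t, f t = 0 -> F t = 0) -> \sum_(t \in supp f) F t = \sum_(t <- s) F t.
Proof.
move=> us fs F0; rewrite [RHS]fsbig_seq//; apply: fsbig_widen => // t [_ /= ft].
by apply: F0; apply/eqP/negP => /negP.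
Qed.

(** All sums over supports are computed along one common list of times; it is
    sorted because positive definiteness is proved by induction on it. *)
Lemma Fplus_common_support (R : realType) (H : hilbertType R) (f g : R -> H) :
  Fplus f -> Fplus g -> exists s : seq R,
  [/\ uniq s, sorted <=%R s, all (>= 0) s & supp f `|` supp g `<=` [set` s]].
Proof.
move=> [finf posf] [fing posg].
have fin : finite_set (supp f `|` supp g) by rewrite finite_setU.
pose s := sort <=%R (finmap.enum_fset (fset_set (supp f `|` supp g))).
have ms t : (t \in s) = (t \in supp f `|` supp g) by rewrite mem_sort in_fset_set.
exists s; split.
- by rewrite sort_uniq finmap.fset_uniq.
- by apply: sort_sorted => x y; exact: le_total.
- apply/allP => t; rewrite ms inE => -[/posf|/posg]; by rewrite /= in_itv /= andbT.
- by move=> t ft /=; rewrite ms inE.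
Qed.

Lemma Fplus_seq (R : realType) (H : hilbertType R) (f : R -> H) (s : seq R) :
  all (>= 0) s -> supp f `<=` [set` s] -> Fplus f.
Proof.
move=> s0 fs; split; first exact: sub_finite_set fs (finite_seq s).
by move=> t /fs /= ts; rewrite in_itv /= andbT; exact: (allP s0).
Qed.

Lemma supp_add (R : realType) (H : hilbertType R) (f g : R -> H) :
  supp (f + g) `<=` supp f `|` supp g.
Proof.
move=> t; rewrite /supp /= => fgt; have [ft|] := eqVneq (f t) 0; [right|by left].
by apply: contra fgt => /eqP gt; apply/eqP; transitivity (f t + g t); rewrite // ft gt addr0.
Qed.

Lemma supp_scale (R : realType) (H : hilbertType R) (c : R[i]) (f : R -> H) :
  supp (c *: f) `<=` supp f.
Proof.
move=> t; rewrite /supp /=; apply: contra => /eqP ft.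
by apply/eqP; transitivity (c *: f t); rewrite // ft scaler0.
Qed.

Section gram.
Variables (R : realType) (V : lmodType R[i]) (b : V -> V -> R) (B : psd b).

Lemma gram_sum (s : seq R) (g : R -> R) (x : R -> V) :
  let z := \sum_(t <- s) (g t)%:C *: x t in
  \sum_(t <- s) \sum_(u <- s) g t * g u * b (x t) (x u) = b z z.
Proof.
rewrite /= (psd_suml B); apply: eq_bigr => t _.
rewrite (psd_sumr B); apply: eq_bigr => u _.
by rewrite (psdZl B) (psdZr B) mulrA.
Qed.

End gram.

Section generating_form.
Variables (R : realType) (H H0 : hilbertType R) (T : R -> {linear H -> H}).
Variables (ip1 ip2 : inner_product H) (C1 C2 lambda tau : R).
Hypotheses (semigroupT : semigroup T) (C1_ge1 : 1 <= C1) (C2_ge1 : 1 <= C2)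
  (lambda_gt0 : 0 < lambda) (tau_gt0 : 0 < tau)
  (norm1 : forall h, rnorm h <= ipnorm ip1 h <= C1 * rnorm h)
  (norm2 : forall h, rnorm h <= ipnorm ip2 h <= C2 * rnorm h)
  (growth1 : forall t, 0 <= t -> opnorm (ipnorm ip1) (T t) <= expR (lambda * t))
  (contr2 : opnorm (ipnorm ip2) (T tau) <= 1).
Variables (m : (circle R -> R[i]) -> R[i]) (J0 : {linear H -> H0})
  (T0 Phi0 : R -> {linear H0 -> H0}).
Hypotheses (meanm : invariant_mean m)
  (complJ0 : completion (mean_form m tau ip2 T) J0)
  (inducedT0 : induced_semigroup T J0 T0)
  (extPhi0 : two_sided_extension T0 Phi0).
Implicit Types (t u r : R) (x y h : H) (f g : R -> H) (s : seq R).

Let T0E h : T 0 h = h. Proof. by case: semigroupT. Qed.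
Let TD t u h : 0 <= t -> 0 <= u -> T (t + u) h = T t (T u h).
Proof. by move=> t0 u0; case: semigroupT => _ _ ->. Qed.

(** The semi-inner product < , >_0 on H. The contraction property and the kernel of
    the form beta are only evaluated on the range of J0, hence stated on H. *)
Definition form0 x y : R := rip (@inner R H0) (J0 x) (J0 y).

Lemma form0_psd : psd form0.
Proof.
have B := rip_psd (@inner R H0).
split=> [x y z|x y|a x y|x y|x]; rewrite /form0.
- by rewrite linearD (psdDl B).
- by rewrite (psdC B).
- by rewrite linearZ /= (psdZl B).
- by rewrite !linearZ /= (psdii B).
- exact: psd_ge0 B _.
Qed.

Let form0E h : form0 h h = complex.Re (mean_form m tau ip2 T h h).
Proof. by rewrite /form0 /rip; case: complJ0 => ->. Qed.

Lemma form0_contraction t h : 0 <= t -> form0 (T t h) (T t h) <= form0 h h.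
Proof.
move=> t0; rewrite !form0E.
exact: (mean_form_contraction semigroupT C1_ge1 C2_ge1 lambda_gt0 tau_gt0 norm1 norm2
  growth1 contr2 meanm).
Qed.

Local Notation K0 := (dilation_kernel form0 T).

Lemma Phi0_kernel t u x y :
  complex.Re (inner (Phi0 (t - u) (J0 x)) (J0 y)) = K0 t u x y.
Proof.
case: extPhi0 => Ppos Pneg; rewrite /dilation_kernel; case: leP => tu.
  have tu0 : 0 <= t - u by rewrite subr_ge0.
  by rewrite Ppos//; have [_ ->] := inducedT0 tu0.
rewrite (psdC form0_psd) /form0 -[LHS]/(rip _ _ _) (psdC (rip_psd _)) /rip.
have tu' : t - u < 0 by rewrite subr_lt0.
rewrite -(Pneg _ tu') opprB; have ut0 : 0 <= u - t by rewrite subr_ge0 ltW.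
by have [_ ->] := inducedT0 ut0.
Qed.

Definition q_kernel t u x y : R :=
  overlap (2 * lambda) 2 t u * rip ip1 (T t x) (T u y) + (1 + tent t u) * K0 t u x y.

Lemma endpointE f s : uniq s -> supp f `<=` [set` s] ->
  endpoint T f = \sum_(t <- s) T t (f t).
Proof. by move=> us fs; apply: fsbig_supp_seq => // t ->; rewrite linear0. Qed.

Local Notation q := (q lambda ip1 T J0 Phi0).

Lemma qE f s : uniq s -> supp f `<=` [set` s] ->
  q f = \sum_(t <- s) \sum_(u <- s) q_kernel t u (f t) (f u).
Proof.
move=> us fs; have P1 := rip_psd ip1.
rewrite /q /q_form complex_ReD.
have -> : complex.Re (beta_form J0 Phi0 f f) =
    \sum_(t <- s) \sum_(u <- s) (1 + tent t u) * K0 t u (f t) (f u).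
  rewrite /beta_form (fsbig_supp_seq us fs); last first.
    move=> t ft0; rewrite fsbig1// => u _.
    by rewrite ft0 !linear0 linear0l mulr0.
  have ReS (F : R -> R[i]) : complex.Re (\sum_(t <- s) F t) = \sum_(t <- s) complex.Re (F t).
    by elim: (s) => [|t s' IH]; rewrite ?big_nil// !big_cons complex_ReD IH.
  rewrite ReS; apply: eq_bigr => t _.
  rewrite (fsbig_supp_seq us fs) ?ReS; last first.
    by move=> u ->; rewrite linear0 linear0r mulr0.
  by apply: eq_bigr => u _; rewrite complex_ReZ Phi0_kernel.
have -> : complex.Re (alpha_form lambda ip1 T f f) =
    \sum_(t <- s) \sum_(u <- s) overlap (2 * lambda) 2 t u * rip ip1 (T t (f t)) (T u (f u)).
  rewrite overlap_kernel /alpha_form /Rintegral_complex /= /integral_to.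
  apply: eq_Rintegral => r _; rewrite complex_ReZ mulNr; congr (_ * _).
  rewrite (gram_sum P1) -[LHS]/(rip ip1 _ _).
  suff -> : trajectory T f r = \sum_(t <- s) (window t r)%:C *: T t (f t) by [].
  by apply: fsbig_supp_seq => // t ->; rewrite linear0 scaler0.
rewrite -big_split; apply: eq_bigr => t _.
by rewrite -big_split.
Qed.

Lemma q_kernelD t u x x' y y' :
  q_kernel t u (x + x') (y + y') + q_kernel t u (x - x') (y - y') =
  2 * q_kernel t u x y + 2 * q_kernel t u x' y'.
Proof.
have P1 := rip_psd ip1; have P0 := form0_psd.
have par (V : lmodType R[i]) (b : V -> V -> R) (B : psd b) (a a' c c' : V) :
    b (a + a') (c + c') + b (a - a') (c - c') = 2 * b a c + 2 * b a' c'.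
  by rewrite !(psdDl B) !(psdDr B) !(psdNl B) !(psdNr B); ring.
rewrite /q_kernel /dilation_kernel.
have h1 := par _ _ P1 (T t x) (T t x') (T u y) (T u y').
case: ifP => _.
  have h2 := par _ _ P0 (T (t - u) x) (T (t - u) x') y y'.
  by move: h1 h2; rewrite -!linearD -!linearB /=; nra.
have h2 := par _ _ P0 x x' (T (u - t) y) (T (u - t) y').
by move: h1 h2; rewrite -!linearD -!linearB /=; nra.
Qed.

Lemma q_kernelZ (c : R[i]) t u x y :
  q_kernel t u (c *: x) (c *: y) = complex.Re `|c| ^+ 2 * q_kernel t u x y.
Proof.
have P1 := rip_psd ip1; have P0 := form0_psd.
have s1 := psdZZ P1 c; have s0 := psdZZ P0 c; move: s1 s0.
set n := complex.Re _ => s1 s0; rewrite /q_kernel /dilation_kernel.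
by case: ifP => _; rewrite !linearZ s1 s0; ring.
Qed.

Section one_element.
Variables (f : R -> H) (s : seq R).
Hypotheses (us : uniq s) (ss : sorted <=%R s) (s0 : all (>= 0) s)
  (fs : supp f `<=` [set` s]).

Let K t u := K0 t u (f t) (f u).
Let G t u := rip ip1 (T t (f t)) (T u (f u)).

Let K_ge0 : forall g : R -> R, 0 <= \sum_(t <- s) \sum_(u <- s) g t * g u * K t u.
Proof.
exact: (dilation_kernel_ge0 form0_psd T0E TD form0_contraction f ss s0).
Qed.

Let G_ge0 : forall g : R -> R, 0 <= \sum_(t <- s) \sum_(u <- s) g t * g u * G t u.
Proof.
by move=> g; rewrite (gram_sum (rip_psd ip1)); exact: psd_ge0 (rip_psd ip1) _.
Qed.

Let alpha := \sum_(t <- s) \sum_(u <- s) overlap (2 * lambda) 2 t u * G t u.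
Let P := \sum_(t <- s) \sum_(u <- s) K t u.
Let tents := \sum_(t <- s) \sum_(u <- s) tent t u * K t u.

Lemma q_split : q f = alpha + (P + tents).
Proof.
rewrite (qE us fs) /alpha /P /tents -!big_split; apply: eq_bigr => t _ /=.
rewrite -!big_split; apply: eq_bigr => u _ /=.
by rewrite /q_kernel /K /G; ring.
Qed.

Let tentsE c : (forall t, t \in s -> t + 1 <= c) ->
  tents = \sum_(t <- s) \sum_(u <- s) overlap 0 c t u * K t u.
Proof.
move=> sc; apply: eq_big_seq => t ts /=; apply: eq_big_seq => u us' /=.
by rewrite overlap_tent ?sc//; exact: (allP s0).
Qed.

Let bound_ex : exists2 c, 2 <= c & forall t, t \in s -> t + 1 <= c.
Proof.
elim: (s) => [|t s' [c c2 cs]]; first by exists 2.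
exists (Num.max c (t + 1)); first by rewrite le_max c2.
move=> u; rewrite inE => /predU1P[->|/cs uc]; first by rewrite le_max lexx orbT.
by rewrite le_max uc.
Qed.

Let P_ge0 : 0 <= P.
Proof.
have := K_ge0 (fun=> 1); rewrite /P.
by under eq_bigr do under eq_bigr do rewrite !mul1r.
Qed.

Let alpha_ge0 : 0 <= alpha. Proof. exact: overlap_kernel_ge0. Qed.

Let tents_ge0 : 0 <= tents.
Proof. by have [c _ /tentsE->] := bound_ex; exact: overlap_kernel_ge0. Qed.

(** The alpha part is an integral of squared norms, and the tent is an integral of
    products of windows, so each of the three sums is nonnegative. *)
Lemma q_ge0 : 0 <= q f.
Proof. by rewrite q_split !addr_ge0. Qed.

Let c t : R := integral_to 2 (window t).

Let c_early t : t \in s -> t < 1 -> 1 - c t = 0.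
Proof.
move=> ts t1; rewrite /c integral_window ?subrr//; first exact: (allP s0).
by lra.
Qed.

(** The vector on the left is the integral over [0, 2] of the trajectory of f. *)
Let early_part : rnorm (\sum_(t <- s) (c t)%:C *: T t (f t)) ^+ 2 <=
  (expR (4 * lambda) - 1) / (2 * lambda) * alpha.
Proof.
have l2 : 2 * lambda != 0 by rewrite mulf_neq0// gt_eqF.
have IE : integral_to 2 (fun r => expR (2 * lambda * r)) =
    (expR (4 * lambda) - 1) / (2 * lambda).
  rewrite /integral_to integral_expR// mulr0 expR0; congr ((expR _ - _) / _).
  by ring.
set z := \sum_(t <- s) _.
have /andP[h1 _] := norm1 z.
apply: (@le_trans _ _ (rip ip1 z z)).
  rewrite -[leRHS](sqr_snorm (rip_psd ip1)) ler_pXn2r ?nnegrE ?snorm_ge0//.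
  exact: rnorm_ge0.
rewrite -(gram_sum (rip_psd ip1)) -IE; apply: (overlap_jensen G_ge0).
rewrite IE divr_gt0 ?mulr_gt0// subr_gt0 -expR0 ltr_expR mulr_gt0//.
Qed.

Let S1 := sup_sqr_opnorm T `[0, 1].

(** The weights 1 - c t vanish for t < 1, so that T 1 can be factored out and its
    smoothing from < , >_0 to the norm applies. By dilation_kernel_later_ge it
    remains to bound the form P at (1 - c) f by twice its values at f and c f; the
    latter is at most twice the tent part by Jensen on [0, 2]. *)
Let late_part : rnorm (\sum_(t <- s) (1 - c t)%:C *: T t (f t)) ^+ 2 <=
  4 * Num.max 1 tau * S1 * (P + tents).
Proof.
have -> : \sum_(t <- s) (1 - c t)%:C *: T t (f t) =
    T 1 (\sum_(t <- s | 1 <= t) T (t - 1) ((1 - c t)%:C *: f t)).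
  rewrite linear_sum [RHS]big_mkcond; apply: eq_big_seq => t ts /=.
  case: ltP => t1; first by rewrite c_early// scale0r.
  by rewrite -TD// ?subr_ge0// (addrC 1 (t - 1)) subrK linearZ.
set z := \sum_(t <- s | _) _.
apply: le_trans (rnorm_T1_le_mean_form semigroupT C1_ge1 C2_ge1 lambda_gt0 tau_gt0 norm1 norm2
  growth1 meanm z) _.
rewrite -form0E -/S1.
have zK : form0 z z <= \sum_(t <- s) \sum_(u <- s) (1 - c t) * (1 - c u) * K t u.
  exact: (dilation_kernel_later_ge form0_psd T0E TD form0_contraction f ss c_early).
(* the form at f - c f is at most twice the sum of its values at f and
   c f, by the parallelogram law and positivity at f + c f *)
have par : \sum_(t <- s) \sum_(u <- s) (1 - c t) * (1 - c u) * K t u =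
    2 * P + 2 * \sum_(t <- s) \sum_(u <- s) c t * c u * K t u -
    \sum_(t <- s) \sum_(u <- s) (1 + c t) * (1 + c u) * K t u.
  rewrite !mulr_sumr -!big_split -sumrB; apply: eq_bigr => t _ /=.
  rewrite !mulr_sumr -!big_split -sumrB; apply: eq_bigr => u _ /=; ring.
have /= plus := K_ge0 (fun t => 1 + c t).
have I2 : integral_to 2 (fun r => expR (0 * r)) = 2.
  rewrite /integral_to; under eq_Rintegral do rewrite mul0r expR0.
  rewrite Rintegral_cst// mul1r /= lebesgue_measure_itv /= lte_fin ltr0n /=.
  by rewrite subr0.
have jensen : \sum_(t <- s) \sum_(u <- s) c t * c u * K t u <= 2 * tents.
  (* enlarge the domain [0, 2] of the overlaps until it contains all windows *)
  have [d d2 /tentsE->] := bound_ex.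
  rewrite -[X in X * _]I2.
  apply: le_trans (overlap_jensen K_ge0 (c := 2) (k := 0) _) _; first by rewrite I2.
  by rewrite I2 ler_wpM2l//; exact: overlap_kernel_mono.
have [S10 _] := sup_sqr_opnorm_ccP semigroupT C1_ge1 lambda_gt0 norm1 growth1 ler01.
have MS : 0 <= Num.max 1 tau * S1 by rewrite mulr_ge0// le_max ler01.
have z4 : form0 z z <= 4 * (P + tents) by have := P_ge0; have := tents_ge0; lra.
by apply: le_trans (ler_wpM2l MS z4) _; rewrite !mulrA [_ * 4]mulrC !mulrA.
Qed.

(** The end point of f is the integral of its trajectory, controlled by alpha,
    plus a late part, controlled by beta. *)
Lemma endpoint_le_q : rnorm (endpoint T f) ^+ 2 <= M2 lambda tau T ^+ 2 * q f.
Proof.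
have [S10 _] := sup_sqr_opnorm_ccP semigroupT C1_ge1 lambda_gt0 norm1 growth1 ler01.
have eA := early_part; have lE := late_part.
set A := (expR (4 * lambda) - 1) / (2 * lambda) in eA.
set E := 4 * Num.max 1 tau * S1 in lE.
have A0 : 0 <= A.
  by rewrite divr_ge0 ?mulr_ge0 ?(ltW lambda_gt0)// subr_ge0 -expR0 ler_expR mulr_ge0// ltW.
have E0 : 0 <= E by rewrite !mulr_ge0// le_max ler01.
have -> : M2 lambda tau T ^+ 2 = A + E by rewrite sqr_sqrtr// addr_ge0.
have -> : endpoint T f = \sum_(t <- s) (c t)%:C *: T t (f t) +
    \sum_(t <- s) (1 - c t)%:C *: T t (f t).
  rewrite (endpointE us fs) -big_split; apply: eq_bigr => t _ /=.
  by rewrite -scalerDl -rmorphD addrC subrK scale1r.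
rewrite q_split.
have PT0 : 0 <= P + tents by rewrite addr_ge0.
move: eA lE; set x := \sum_(t <- s) _; set y := \sum_(t <- s) _.
move=> xA yE; have x0 := rnorm_ge0 x; have y0 := rnorm_ge0 y.
apply: (@le_trans _ _ ((rnorm x + rnorm y) ^+ 2)).
  by rewrite ler_pXn2r ?nnegrE ?rnorm_ge0 ?addr_ge0//; exact: ler_rnormD.
(* x * y <= sqrt (A alpha) * sqrt (E (P + tents)), then the arithmetic-geometric
   mean inequality *)
have cross : 2 * (rnorm x * rnorm y) <= A * (P + tents) + E * alpha.
  have rhs0 : 0 <= A * (P + tents) + E * alpha by apply: addr_ge0; exact: mulr_ge0.
  have lhs0 : 0 <= 2 * (rnorm x * rnorm y) by rewrite !mulr_ge0.
  rewrite -(@ler_pXn2r _ 2)//.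
  have h := ler_pM (sqr_ge0 _) (sqr_ge0 _) xA yE.
  apply: (@le_trans _ _ (4 * (A * alpha * (E * (P + tents))))).
    by rewrite !exprMn; lra.
  by have := sqr_ge0 (A * (P + tents) - E * alpha); lra.
by rewrite sqrrD; lra.
Qed.

Definition delay (sg : R) f : R -> H := fun t => f (t - sg).

Let supp_delay (sg : R) : supp (delay sg f) `<=` [set` [seq t + sg | t <- s]].
Proof.
move=> t /= ft; apply/mapP; exists (t - sg); last by rewrite subrK.
exact: fs.
Qed.

Let uniq_delay (sg : R) : uniq [seq t + sg | t <- s].
Proof. by rewrite map_inj_uniq//; exact: addIr. Qed.

Lemma Fplus_delay (sg : R) : 0 <= sg -> Fplus (delay sg f).
Proof.
move=> sg0; apply: (Fplus_seq (s := [seq t + sg | t <- s])); last exact: supp_delay.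
by rewrite all_map; apply/allP => t /(allP s0) t0 /=; rewrite addr_ge0.
Qed.

Lemma endpoint_delay (sg : R) : 0 <= sg ->
  endpoint T (delay sg f) = T sg (endpoint T f).
Proof.
move=> sg0; rewrite (endpointE (uniq_delay sg) (supp_delay (sg := sg))) (endpointE us fs).
rewrite big_map linear_sum; apply: eq_big_seq => t /(allP s0) t0.
by rewrite /delay addrK addrC TD.
Qed.

(** The beta part depends only on differences of times. In the alpha part, the
    factor exp (- 2 lambda sg) gained by the delay compensates the growth of T sg,
    and the truncation of [0, 2] to [0, 2 - sg] discards a nonnegative amount. *)
Lemma q_delay (sg : R) : 0 <= sg -> q (delay sg f) <= q f.
Proof.
move=> sg0; pose e := expR (2 * lambda * sg).
pose G' t u := rip ip1 (T sg (T t (f t))) (T sg (T u (f u))).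
(* the growth bound for T sg, as semidefiniteness of a difference of kernels *)
have D_ge0 (g : R -> R) : 0 <= \sum_(t <- s) \sum_(u <- s) g t * g u * (e * G t u - G' t u).
  have -> : \sum_(t <- s) \sum_(u <- s) g t * g u * (e * G t u - G' t u) =
      e * (\sum_(t <- s) \sum_(u <- s) g t * g u * G t u) -
      \sum_(t <- s) \sum_(u <- s) g t * g u * G' t u.
    rewrite mulr_sumr -sumrB; apply: eq_bigr => t _.
    by rewrite mulr_sumr -sumrB; apply: eq_bigr => u _; ring.
  rewrite !(gram_sum (rip_psd ip1)) subr_ge0.
  set z := \sum_(t <- s) (g t)%:C *: T t (f t).
  have -> : \sum_(t <- s) (g t)%:C *: T sg (T t (f t)) = T sg z.
    by rewrite linear_sum; apply: eq_bigr => t _; rewrite linearZ.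
  have gz := ipnorm1_growth semigroupT C1_ge1 norm1 growth1 z sg0.
  have -> : e = expR (lambda * sg) ^+ 2.
    by rewrite /e -expRM_natl; congr expR; ring.
  rewrite -!sqr_ipnorm -exprMn ler_pXn2r ?nnegrE ?sqrtr_ge0//.
  by rewrite mulr_ge0 ?expR_ge0 ?sqrtr_ge0.
have early : \sum_(t <- s) \sum_(u <- s) overlap (2 * lambda) 2 (t + sg) (u + sg) * G' t u <=
    alpha.
  have l2 : 2 * lambda != 0 by rewrite mulf_neq0// gt_eqF.
  apply: le_trans (overlap_kernel_mono G_ge0 (c := 2 - sg) (c' := 2) _ _); last first.
    by rewrite gerBl.
  have e0 : 0 < e by exact: expR_gt0.
  have -> : \sum_(t <- s) \sum_(u <- s) overlap (2 * lambda) 2 (t + sg) (u + sg) * G' t u =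
      e^-1 * \sum_(t <- s) \sum_(u <- s) overlap (2 * lambda) (2 - sg) t u * G' t u.
    rewrite mulr_sumr; apply: eq_big_seq => t ts.
    rewrite mulr_sumr; apply: eq_big_seq => u us'.
    rewrite overlap_shift//; [|exact: (allP s0)|exact: (allP s0)].
    by rewrite /e mulNr expRN mulrA.
  rewrite ler_pdivrMl// mulr_sumr -subr_ge0 -sumrB.
  have := overlap_kernel_ge0 D_ge0 (2 - sg) (2 * lambda).
  congr (is_true (_ <= _)); apply: eq_bigr => t _.
  by rewrite mulr_sumr -sumrB; apply: eq_bigr => u _; ring.
rewrite q_split (qE (uniq_delay sg) (supp_delay (sg := sg))) big_map.
under eq_bigr do rewrite big_map.
apply: le_trans (lerD early (lexx _)).
rewrite /P /tents -!big_split le_eqVlt; apply/orP; left; apply/eqP.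
apply: eq_big_seq => t /(allP s0) t0 /=; rewrite -!big_split.
apply: eq_big_seq => u /(allP s0) u0 /=.
rewrite /delay !addrK /q_kernel /G' /K /dilation_kernel /tent lerD2r.
rewrite -!TD// ![sg + _]addrC.
have -> : t + sg - (u + sg) = t - u by ring.
have -> : u + sg - (t + sg) = u - t by ring.
by congr (_ + _); rewrite mulrDl mul1r.
Qed.

End one_element.

Definition initial h : R -> H := fun t => if t == 0 then h else 0.

Let supp_initial h : supp (initial h) `<=` [set` [:: (0 : R)]].
Proof. by move=> t /=; rewrite /supp /initial /= inE; case: (t == 0) => //=; rewrite eqxx. Qed.

Lemma Fplus_initial h : Fplus (initial h).
Proof. by apply: (Fplus_seq (s := [:: 0])); [rewrite /= lexx | exact: supp_initial]. Qed.

Lemma endpoint_initial h : endpoint T (initial h) = h.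
Proof. by rewrite (endpointE _ (supp_initial (h := h)))// big_seq1 /initial eqxx T0E. Qed.

Lemma q_initial_le h : q (initial h) <= M1 C1 C2 lambda tau T ^+ 2 * rnorm h ^+ 2.
Proof.
have l20 : 0 < 2 * lambda by rewrite mulr_gt0.
have [S0 _] := sup_sqr_opnorm_coP semigroupT C1_ge1 lambda_gt0 norm1 growth1 tau_gt0.
set S := sup_sqr_opnorm T _ in S0.
set A := (1 - expR (- (4 * lambda))) / (2 * lambda).
have A0 : 0 <= A.
  rewrite divr_ge0 ?(ltW l20)// subr_ge0 -expR0 ler_expR oppr_le0 mulr_ge0//.
  exact: ltW.
have C20 : 0 <= C2 ^+ 2 * S by rewrite mulr_ge0// sqr_ge0.
have -> : M1 C1 C2 lambda tau T ^+ 2 = C1 ^+ 2 * A + 2 * C2 ^+ 2 * S.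
  by rewrite sqr_sqrtr// -mulrA addr_ge0// mulr_ge0// sqr_ge0.
rewrite (qE _ (supp_initial (h := h)))// !big_seq1 /initial eqxx /q_kernel !T0E.
have -> : K0 0 0 h h = form0 h h by rewrite /dilation_kernel lexx subrr T0E.
have -> : tent 0 0 = 1 :> R by rewrite /tent subrr normr0 subr0; apply/max_idPl.
have -> : overlap (2 * lambda) 2 0 0 = (1 - expR (- (2 * lambda))) / (2 * lambda).
  rewrite overlapE// maxxx minxx add0r (_ : Num.min 2 1 = 1); last first.
    by apply/min_idPr; rewrite ler1n.
  rewrite integral_expR ?oppr_eq0 ?gt_eqF// mulr0 expR0 mulr1.
  by field; rewrite gt_eqF.
have h0 : form0 h h <= C2 ^+ 2 * S * rnorm h ^+ 2.
  rewrite form0E; exact: (mean_form_le semigroupT C1_ge1 C2_ge1 lambda_gt0 tau_gt0 norm1 norm2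
  growth1 meanm).
have h1 : (1 - expR (- (2 * lambda))) / (2 * lambda) <= A.
  rewrite ler_pM2r ?invr_gt0// lerD2l lerN2 ler_expR lerN2 ler_pM2r// ler_nat.
  by [].
have h2 : rip ip1 h h <= C1 ^+ 2 * rnorm h ^+ 2.
  rewrite -sqr_ipnorm -exprMn ler_pXn2r ?nnegrE ?sqrtr_ge0//.
    by have /andP[] := norm1 h.
  by rewrite mulr_ge0 ?rnorm_ge0// (le_trans _ C1_ge1).
have h3 := psd_ge0 (rip_psd ip1) h.
have := ler_pM _ h3 h1 h2; rewrite divr_ge0 ?(ltW l20)//; last first.
  by rewrite subr_ge0 -[leRHS]expR0 ler_expR oppr_le0 (ltW l20).
by move=> /(_ isT); lra.
Qed.

End generating_form.

(** * Quotient norms *)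

Section quotient_norm.
Variables (R : realType) (W V : lmodType R[i]) (F : set W) (Sg : W -> V) (q : W -> R).
Hypotheses (FD : forall f g, F f -> F g -> F (f + g))
  (FZ : forall (c : R[i]) f, F f -> F (c *: f))
  (SgD : forall f g, F f -> F g -> Sg (f + g) = Sg f + Sg g)
  (SgZ : forall (c : R[i]) f, F f -> Sg (c *: f) = c *: Sg f)
  (Sg_onto : forall h, exists2 f, F f & Sg f = h)
  (q_ge0 : forall f, F f -> 0 <= q f)
  (q_par : forall f g, F f -> F g -> q (f + g) + q (f - g) = 2 * q f + 2 * q g)
  (qZ : forall (c : R[i]) f, F f -> q (c *: f) = complex.Re `|c| ^+ 2 * q f).

Definition quotient_norm h : R := inf [set Num.sqrt (q f) | f in F `&` [set f | Sg f = h]].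

Local Notation N := quotient_norm.

Lemma quotient_norm_le f : F f -> N (Sg f) <= Num.sqrt (q f).
Proof.
move=> Ff; apply: ge_inf; last by exists f.
by exists 0 => _ [g _ <-]; exact: sqrtr_ge0.
Qed.

Lemma le_quotient_norm (a : R) h : (forall f, F f -> Sg f = h -> a <= Num.sqrt (q f)) ->
  a <= N h.
Proof.
move=> aq; apply: lb_le_inf.
  by have [f Ff fh] := Sg_onto h; exists (Num.sqrt (q f)), f.
by move=> _ [f [Ff fh] <-]; exact: aq.
Qed.

Lemma quotient_norm_ge0 h : 0 <= N h.
Proof. by apply: le_quotient_norm => f _ _; exact: sqrtr_ge0. Qed.

Lemma sqr_quotient_norm_le f : F f -> N (Sg f) ^+ 2 <= q f.
Proof.
move=> Ff; rewrite -[leRHS]sqr_sqrtr ?q_ge0//.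
by rewrite ler_pXn2r ?nnegrE ?quotient_norm_ge0 ?sqrtr_ge0// quotient_norm_le.
Qed.

Lemma le_sqr_quotient_norm (a : R) h : (forall f, F f -> Sg f = h -> a <= q f) ->
  a <= N h ^+ 2.
Proof.
move=> aq; have [a0|a0] := leP a 0; first exact: le_trans a0 (sqr_ge0 _).
rewrite -[leLHS]sqr_sqrtr ?(ltW a0)// ler_pXn2r ?nnegrE ?quotient_norm_ge0 ?sqrtr_ge0//.
by apply: le_quotient_norm => f Ff fh; rewrite ler_wsqrtr// aq.
Qed.

Let FB f g : F f -> F g -> F (f - g).
Proof. by move=> Ff Fg; rewrite -scaleN1r; apply: FD => //; exact: FZ. Qed.

Let SgB f g : F f -> F g -> Sg (f - g) = Sg f - Sg g.
Proof.
move=> Ff Fg; rewrite -[in LHS]scaleN1r SgD//; last exact: FZ.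
by rewrite SgZ// scaleN1r.
Qed.

Lemma quotient_normZ (c : R[i]) h : N (c *: h) ^+ 2 = complex.Re `|c| ^+ 2 * N h ^+ 2.
Proof.
have le_cN (d : R[i]) k : N (d *: k) ^+ 2 <= complex.Re `|d| ^+ 2 * N k ^+ 2.
  have [->|d0] := eqVneq d 0.
    have [f Ff fk] := Sg_onto k.
    rewrite -fk -SgZ//; apply: le_trans (sqr_quotient_norm_le (FZ _ Ff)) _.
    by rewrite qZ// normr0 /= expr0n !mul0r.
  have n0 : 0 < complex.Re `|d| ^+ 2.
    by rewrite exprn_gt0//; move: (d0); rewrite -normr_gt0 ltcE => /andP[].
  rewrite -ler_pdivrMl//; apply: le_sqr_quotient_norm => f Ff fk.
  rewrite ler_pdivrMl// -qZ// -fk -SgZ//; apply: sqr_quotient_norm_le.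
  exact: FZ.
apply/eqP; rewrite eq_le le_cN andTb.
have [->|c0] := eqVneq c 0; first by rewrite normr0 /= expr0n mul0r sqr_ge0.
have := le_cN c^-1 (c *: h); rewrite scalerA mulVf// scale1r => h1.
have n0 : 0 < complex.Re `|c| ^+ 2.
  by rewrite exprn_gt0//; move: (c0); rewrite -normr_gt0 ltcE => /andP[].
have nV : complex.Re `|c^-1| ^+ 2 = (complex.Re `|c| ^+ 2)^-1.
  apply: (mulIf (lt0r_neq0 n0)); rewrite mulVf ?gt_eqF// -exprMn.
  have -> : complex.Re `|c^-1| * complex.Re `|c| = 1.
    have /(congr1 (@complex.Re _)) : `|c^-1| * `|c| = 1 :> R[i].
      by rewrite -normrM mulVf// normr1.
    by rewrite !normc_def -rmorphM.
  by rewrite expr1n.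
by move: h1; rewrite nV ler_pdivlMl.
Qed.

(** Adding and subtracting representatives gives one inequality; applied to h + k
    and h - k it gives the other. *)
Lemma quotient_norm_parallelogram h k :
  N (h + k) ^+ 2 + N (h - k) ^+ 2 = 2 * N h ^+ 2 + 2 * N k ^+ 2.
Proof.
have par x y : N (x + y) ^+ 2 + N (x - y) ^+ 2 <= 2 * N x ^+ 2 + 2 * N y ^+ 2.
  rewrite -lerBlDr -ler_pdivrMl//; apply: le_sqr_quotient_norm => f Ff <-.
  rewrite ler_pdivrMl// lerBlDr [leRHS]addrC -lerBlDr -ler_pdivrMl//.
  apply: le_sqr_quotient_norm => g Fg <-.
  rewrite ler_pdivrMl// lerBlDr [leRHS]addrC -q_par// -SgD// -SgB//.
  by apply: lerD; apply: sqr_quotient_norm_le; [exact: FD | exact: FB].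
apply/eqP; rewrite eq_le par/=.
have := par (h + k) (h - k).
have -> : h + k + (h - k) = (2 : R[i]) *: h.
  by rewrite addrACA subrr addr0 -mulr2n scaler_nat.
have -> : h + k - (h - k) = (2 : R[i]) *: k.
  by rewrite opprB addrC addrA addrNK -mulr2n scaler_nat.
rewrite !quotient_normZ.
have -> : complex.Re `|2 : R[i]| ^+ 2 = 4 :> R.
  by rewrite ger0_norm ?ler0n// -[2 : R[i]](rmorph_nat (real_complex R)) /=; ring.
by lra.
Qed.

End quotient_norm.

(** * Similarity to contractions *)

Section similarity.
Variables (R : realType) (H : hilbertType R).

(** An isometry A of H with norm N onto H transports the N-contractions T t to
    contractions, and the norms of A and its inverse are at most the constants
    that compare N with the norm of H. *)
Lemma hilbertian_norm_similarity (T : R -> {linear H -> H}) (N : H -> R) :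
  equivalent_hilbertian_norm N -> (forall h t, 0 <= t -> N (T t h) <= N h) ->
  SC T /\ (similarity_constant T <= CH N)%E.
Proof.
move=> [[ip Nip] [c [C [c0 C0 cC]]]] NT.
have cCip h : c * rnorm h <= ipnorm ip h <= C * rnorm h by rewrite -Nip.
have [A [A1 [AK A1K AN]]] := hilbertian_isometry c0 C0 cCip.
have NA1 h : N (A1 h) = rnorm h by rewrite Nip -AN A1K.
have contA : continuous A.
  apply/continuous_boundedP; exists C; first exact: ltW.
  by move=> h; rewrite AN; have /andP[] := cCip h.
have contA1 : continuous A1.
  apply/continuous_boundedP; exists c^-1; first by rewrite invr_ge0 ltW.
  by move=> h; rewrite ler_pdivlMl// -(NA1 h); have /andP[] := cC (A1 h).
have sim : contractive_similarity T A A1.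
  split=> // t t0; apply: rnorm_opnorm_le => // h.
  by rewrite mul1r /= AN -Nip -NA1 NT.
split; first by exists A, A1.
apply: le_ereal_inf_tmp => _ [M [M' [M0 M0' NM NM' ->]]].
apply: (@le_trans _ _ ((opnorm (@rnorm R H) A * opnorm (@rnorm R H) A1)%:E)).
  by apply: ereal_inf_lbound; exists A, A1.
have ge0 (L : H -> H) : L 0 = 0 -> (exists2 K, 0 <= K & forall h, rnorm (L h) <= K * rnorm h) ->
    0 <= opnorm (@rnorm R H) L.
  move=> L0 [K K0 LK]; apply: (@le_trans _ _ (rnorm (L 0))).
    exact: rnorm_ge0.
  apply: ub_le_sup; last by exists 0 => //=; rewrite rnorm0 ler01.
  exists K => _ [h /= h1 <-]; apply: le_trans (LK h) _.
  by rewrite -[leRHS]mulr1 ler_wpM2l.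
have bA h : rnorm (A h) <= M' * rnorm h by rewrite AN -Nip.
have bA1 h : rnorm (A1 h) <= M * rnorm h by rewrite -[rnorm h]NA1.
rewrite lee_fin [M * _]mulrC; apply: ler_pM; try exact: rnorm_opnorm_le.
  by apply: ge0; [exact: linear0 | exists M'].
by apply: ge0; [exact: linear0 | exists M].
Qed.

End similarity.

Theorem theorem3p5 (R : realType) (H : hilbertType R)
    (T : R -> {linear H -> H}) (semigroupT : semigroup T)
    (ip1 ip2 : inner_product H) (C1 C2 lambda tau : R)
    (C1_ge1 : 1 <= C1) (C2_ge1 : 1 <= C2)
    (lambda_gt0 : 0 < lambda) (tau_gt0 : 0 < tau)
    (norm1 : forall h, rnorm h <= ipnorm ip1 h <= C1 * rnorm h)
    (norm2 : forall h, rnorm h <= ipnorm ip2 h <= C2 * rnorm h)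
    (growth1 : forall t, 0 <= t -> opnorm (ipnorm ip1) (T t) <= expR (lambda * t))
    (contr2 : opnorm (ipnorm ip2) (T tau) <= 1)
    (m : (circle R -> R[i]) -> R[i]) (meanm : invariant_mean m)
    (H0 : hilbertType R) (J0 : {linear H -> H0})
    (complJ0 : completion (mean_form m tau ip2 T) J0)
    (T0 Phi0 : R -> {linear H0 -> H0})
    (inducedT0 : induced_semigroup T J0 T0)
    (extPhi0 : two_sided_extension T0 Phi0) :
  let N := norm_eq lambda ip1 T J0 Phi0 in
  let m1 := M1 C1 C2 lambda tau T in
  let m2 := M2 lambda tau T in
  [/\ equivalent_hilbertian_norm N,
      forall h t, 0 <= t -> N (T t h) <= N h,
      SC T,
      forall h, m2^-1 * rnorm h <= N h <= m1 * rnorm h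
    & (similarity_constant T <= CH N)%E /\ (CH N <= (m1 * m2)%:E)%E].
Proof.
move=> N m1 m2.
have C1_gt0 : 0 < C1 by rewrite (lt_le_trans _ C1_ge1).
have C2_ge0 : 0 <= C2 by rewrite (le_trans _ C2_ge1).
have m1_gt0 : 0 < m1.
  rewrite sqrtr_gt0 ltr_wpDr//.
    rewrite !mulr_ge0// -/(sup_sqr_opnorm T `[0, tau[).
    by have [] := sup_sqr_opnorm_coP semigroupT C1_ge1 lambda_gt0 norm1 growth1 tau_gt0.
  rewrite mulr_gt0 ?exprn_gt0// divr_gt0 ?mulr_gt0// subr_gt0.
  by rewrite -[ltRHS]expR0 ltr_expR oppr_lt0 mulr_gt0.
have m2_gt0 : 0 < m2.
  rewrite sqrtr_gt0 ltr_wpDr//.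
    rewrite !mulr_ge0// ?le_max ?ler01// -/(sup_sqr_opnorm T `[0, 1]).
    by have [] := sup_sqr_opnorm_ccP semigroupT C1_ge1 lambda_gt0 norm1 growth1 ler01.
  rewrite divr_gt0 ?mulr_gt0// subr_gt0.
  by rewrite -[ltLHS]expR0 ltr_expR mulr_gt0.
pose qf := q lambda ip1 T J0 Phi0.
have qseq (f : R -> H) (s : seq R) := @qE R H H0 T ip1 lambda J0 T0 Phi0
  inducedT0 extPhi0 f s.
have Fplus1 (f : R -> H) : Fplus f -> exists s : seq R,
    [/\ uniq s, sorted <=%R s, all (>= 0) s & supp f `<=` [set` s]].
  by move=> Ff; have := Fplus_common_support Ff Ff; rewrite setUid.
have FplusD (f g : R -> H) : Fplus f -> Fplus g -> Fplus (f + g).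
  move=> Ff Fg; have [s [us ss s0 fgs]] := Fplus_common_support Ff Fg.
  by apply: (Fplus_seq s0); exact: subset_trans (@supp_add _ _ f g) fgs.
have FplusZ (c : R[i]) (f : R -> H) : Fplus f -> Fplus (c *: f).
  move=> Ff; have [s [us ss s0 fs]] := Fplus1 f Ff.
  by apply: (Fplus_seq s0); exact: subset_trans (@supp_scale _ _ c f) fs.
have endD (f g : R -> H) : Fplus f -> Fplus g ->
    endpoint T (f + g) = endpoint T f + endpoint T g.
  move=> Ff Fg; have [s [us ss s0]] := Fplus_common_support Ff Fg; rewrite subUset => -[fs gs].
  rewrite (endpointE T us fs) (endpointE T us gs) -big_split.
  rewrite (endpointE T us (f := f + g)); last first.
    by apply: subset_trans (@supp_add _ _ f g) _; rewrite subUset.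
  by apply: eq_bigr => t _; exact: linearD.
have endZ (c : R[i]) (f : R -> H) : Fplus f -> endpoint T (c *: f) = c *: endpoint T f.
  move=> Ff; have [s [us ss s0 fs]] := Fplus1 f Ff.
  rewrite (endpointE T us fs) (endpointE T us (subset_trans (@supp_scale _ _ c f) fs)).
  by rewrite scaler_sumr; apply: eq_bigr => t _; exact: linearZ.
have onto h : exists2 f, Fplus f & endpoint T f = h.
  by exists (initial h); [exact: Fplus_initial | exact: (endpoint_initial semigroupT)].
have q0 (f : R -> H) : Fplus f -> 0 <= qf f.
  move=> Ff; have [s [us ss s0 fs]] := Fplus1 f Ff.
  exact: (q_ge0 semigroupT C1_ge1 C2_ge1 lambda_gt0 tau_gt0 norm1 norm2 growth1 contr2
    meanm complJ0 inducedT0 extPhi0 us ss s0 fs).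
have qpar (f g : R -> H) : Fplus f -> Fplus g ->
    qf (f + g) + qf (f - g) = 2 * qf f + 2 * qf g.
  move=> Ff Fg; have [s [us ss s0]] := Fplus_common_support Ff Fg; rewrite subUset => -[fs gs].
  have fgs : supp (f + g) `<=` [set` s].
    by apply: subset_trans (@supp_add _ _ f g) _; rewrite subUset.
  have fgs' : supp (f - g) `<=` [set` s].
    rewrite -scaleN1r; apply: subset_trans (@supp_add _ _ f _) _; rewrite subUset; split => //.
    exact: subset_trans (@supp_scale _ _ _ g) gs.
  rewrite /qf (qseq _ s us fs) (qseq _ s us gs) (qseq _ s us fgs) (qseq _ s us fgs').
  rewrite !mulr_sumr -!big_split; apply: eq_bigr => t _ /=.
  rewrite !mulr_sumr -!big_split; apply: eq_bigr => u _ /=.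
  exact: q_kernelD.
have qZ (c : R[i]) (f : R -> H) : Fplus f -> qf (c *: f) = complex.Re `|c| ^+ 2 * qf f.
  move=> Ff; have [s [us ss s0 fs]] := Fplus1 f Ff.
  rewrite /qf (qseq _ s us fs) (qseq _ s us (subset_trans (@supp_scale _ _ c f) fs)).
  rewrite mulr_sumr; apply: eq_bigr => t _; rewrite mulr_sumr; apply: eq_bigr => u _.
  exact: q_kernelZ.
have N_ge0 h : 0 <= N h := quotient_norm_ge0 qf onto h.
have NZ := quotient_normZ FplusZ endZ onto q0 qZ.
have Npar := quotient_norm_parallelogram FplusD FplusZ endD endZ onto q0 qpar qZ.
have upper h : N h <= m1 * rnorm h.
  rewrite -(@ler_pXn2r _ 2)// ?nnegrE ?N_ge0 ?mulr_ge0 ?rnorm_ge0 ?(ltW m1_gt0)//.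
  rewrite exprMn -[in X in X <= _](endpoint_initial semigroupT h).
  apply: le_trans (sqr_quotient_norm_le onto q0 (Fplus_initial h)) _.
  exact: (q_initial_le semigroupT C1_ge1 C2_ge1 lambda_gt0 tau_gt0 norm1 norm2 growth1
    meanm complJ0 inducedT0 extPhi0).
have lower h : rnorm h <= m2 * N h.
  rewrite -(@ler_pXn2r _ 2)// ?nnegrE ?N_ge0 ?mulr_ge0 ?rnorm_ge0 ?(ltW m2_gt0)//.
  rewrite exprMn -ler_pdivrMl ?exprn_gt0//.
  apply: (le_sqr_quotient_norm onto) => f Ff <-; rewrite ler_pdivrMl ?exprn_gt0//.
  have [s [us ss s0 fs]] := Fplus1 f Ff.
  exact: (endpoint_le_q semigroupT C1_ge1 C2_ge1 lambda_gt0 tau_gt0 norm1 norm2 growth1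
    contr2 meanm complJ0 inducedT0 extPhi0 us ss s0 fs).
have NT h t : 0 <= t -> N (T t h) <= N h.
  move=> t0; apply: (le_quotient_norm onto) => f Ff <-.
  have [s [us ss s0 fs]] := Fplus1 f Ff.
  rewrite -(endpoint_delay semigroupT us s0 fs t0).
  apply: le_trans (quotient_norm_le _ qf (Fplus_delay s0 fs t0)) _.
  apply: ler_wsqrtr.
  exact: (q_delay semigroupT C1_ge1 lambda_gt0 norm1 growth1 inducedT0 extPhi0 us s0 fs t0).
have hilbertian : equivalent_hilbertian_norm N.
  split; last first.
    exists m2^-1, m1; split => //; first by rewrite invr_gt0.
    by move=> h; rewrite upper ler_pdivrMl// lower.
  have NZr (a : R) h : N (a%:C *: h) ^+ 2 = a ^+ 2 * N h ^+ 2.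
    by rewrite NZ normc_def /= expr0n addr0 sqr_sqrtr ?sqr_ge0.
  have Ni h : N ('i%C *: h) ^+ 2 = N h ^+ 2.
    by rewrite NZ normc_def /= expr0n add0r expr1n sqrtr1 expr1n mul1r.
  have [B BN] := jordan_von_neumann (fun h => sqr_ge0 (N h)) NZr Ni Npar.
  have [|ip ipE] := inner_product_of_form B.
    move=> h h0; rewrite BN exprn_gt0// lt_def N_ge0 andbT; apply: contra h0 => /eqP Nh.
    have := lower h; rewrite Nh mulr0 => hle; apply/eqP/rnorm_eq0/eqP.
    by rewrite eq_le hle rnorm_ge0.
  by exists ip => h; rewrite /ipnorm ipE /= BN sqrtr_sqr ger0_norm.
have [simT simC] := hilbertian_norm_similarity hilbertian NT.
split => //; first by move=> h; rewrite upper ler_pdivrMl// lower.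
split => //; apply: ereal_inf_lbound; exists m2, m1; by split; rewrite ?ltW// mulrC.
Qed.
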